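(* Let $p_{i-1}, p_i, p_{i+1}$ be points in the plane, and let $\beta_i$, with $0 < |\beta_i| \le \pi/2$, be the signed angle between the vectors $\overrightarrow{p_{i-1}p_i}$ and $\overrightarrow{p_i p_{i+1}}$. Let $c_i \in \mathbb{R}_{>0}\cup\{+\infty\}$ be a clearance parameter defining the safe zone of the pair of segments $([p_{i-1},p_i],[p_i,p_{i+1}])$ as described in the context. Consider a circle arc of curvature $\kappa_C$ that interpolates the two segments within their safe zone, i.e. it is tangent to both segments and lies in the safe zone. Then for every curvatures $\kappa_1, \kappa_2$ with $0 \le \kappa_1 < \kappa_C$ and $0 \le \kappa_2 < \kappa_C$, there exist two clothoid arcs, the first one with curvature varying (linearly with traveled distance) from $\kappa_1$ to some value $\kappa_M$ and the second one with curvature varying from $\kappa_M$ to $\kappa_2$, where $\kappa_M > \kappa_C$, such that the concatenation of the two arcs interpolates the path from $p_{i-1}$ to $p_{i+1}$ within the safe zone, with continuity of the tangent vector at the junction point between the two arcs. Moreover, the parameters of these two clothoid arcs are uniquely determined by $\kappa_1$, $\kappa_2$, $\kappa_C$ and $\beta_i$.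
   Context: Curvature is signed, and the situation considered is the one where the circle arc has positive curvature $\kappa_C > 0$ (turning in the positive direction); the case of negative curvature is symmetric. Safe zone: given two adjacent segments $[p_{i-1},p_i]$ and $[p_i,p_{i+1}]$ and a clearance parameter $c_i>0$ (if $c_i=+\infty$ it is replaced by the smaller of the two segment lengths), let $D_i$ be the disk tangent to both segments whose points of tangency with the segments are at distance $c_i$ from $p_i$ (its center lies on the inner bisector of the angle at $p_i$). The safe zone of the pair of segments is the region located between the disk $D_i$ and the two segments, together with the segments themselves. A clothoid arc is a planar curve whose (signed) curvature varies linearly (affinely) with arc length. ''Interpolating the path within the safe zone'' means the curve leads from the segment $[p_{i-1},p_i]$ to the segment $[p_i,p_{i+1}]$, changes the tangent orientation by the total angle $\beta_i$ (the integral of curvature along the two arcs equals $\beta_i$), and is contained in the safe zone. The parameters of the two clothoid arcs are their linear curvature rates $d_1$ and $-d_2$, the length $s_M$ of the first arc and the total length $s_F$ of both arcs, with $\kappa_M = \kappa_1 + d_1 s_M = \kappa_2 + d_2(s_F - s_M)$.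
   Formalization: The two clothoid arcs are required to start and end at the same points as the given circle arc; among such pairs the parameters are unique. Without this condition uniqueness fails: for κ1=κ2=0, shrinking a solution toward p_i gives another valid pair with different parameters. *)

(* Defs.v *)
From Stdlib Require Import Reals Lra.
From Coquelicot Require Import Coquelicot.
Open Scope R_scope.

Definition pt := (R * R)%type.

Definition vsub (a b : pt) : pt := (fst a - fst b, snd a - snd b).
Definition vdot (u v : pt) : R := fst u * fst v + snd u * snd v.
Definition vcross (u v : pt) : R := fst u * snd v - snd u * fst v.
Definition vnorm (u : pt) : R := sqrt (vdot u u).

Definition signed_angle (u v : pt) (beta : R) : Prop :=
  u <> (0, 0) /\ v <> (0, 0) /\ - PI < beta <= PI /\
  cos beta * (vnorm u * vnorm v) = vdot u v /\
  sin beta * (vnorm u * vnorm v) = vcross u v.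

Definition on_seg (a b x : pt) : Prop :=
  exists t, 0 <= t <= 1 /\
    x = ((1 - t) * fst a + t * fst b, (1 - t) * snd a + t * snd b).

Definition in_triangle (a b g x : pt) : Prop :=
  exists la lb lg, 0 <= la /\ 0 <= lb /\ 0 <= lg /\ la + lb + lg = 1 /\
    x = (la * fst a + lb * fst b + lg * fst g, la * snd a + lb * snd b + lg * snd g).

(** Clearance parameter c in R_{>0} ∪ {+oo}: [None] encodes +oo, which is
    replaced by the smaller of the two segment lengths. *)
Definition eff_clearance (p0 p1 p2 : pt) (c : option R) : R :=
  match c with
  | Some r => r
  | None => Rmin (vnorm (vsub p1 p0)) (vnorm (vsub p2 p1))
  end.

Definition valid_clearance (c : option R) : Prop :=
  match c with Some r => 0 < r | None => True end.

Definition tang1 (p0 p1 p2 : pt) (c : option R) : pt :=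
  let u := vsub p1 p0 in let k := eff_clearance p0 p1 p2 c / vnorm u in
  (fst p1 - k * fst u, snd p1 - k * snd u).
Definition tang2 (p0 p1 p2 : pt) (c : option R) : pt :=
  let v := vsub p2 p1 in let k := eff_clearance p0 p1 p2 c / vnorm v in
  (fst p1 + k * fst v, snd p1 + k * snd v).

Definition is_safe_disk (p0 p1 p2 : pt) (c : option R) (o : pt) (r : R) : Prop :=
  0 < r /\
  vdot (vsub o (tang1 p0 p1 p2 c)) (vsub p1 p0) = 0 /\
  vdot (vsub o (tang2 p0 p1 p2 c)) (vsub p2 p1) = 0 /\
  vnorm (vsub o (tang1 p0 p1 p2 c)) = r /\
  vnorm (vsub o (tang2 p0 p1 p2 c)) = r.

(** Safe zone: the two segments, together with the region between the disk
    and the two segments (the part of the triangle tang1, p1, tang2 lying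
    outside the open disk). *)
Definition in_safe_zone (p0 p1 p2 : pt) (c : option R) (x : pt) : Prop :=
  on_seg p0 p1 x \/ on_seg p1 p2 x \/
  (forall o r, is_safe_disk p0 p1 p2 c o r ->
     in_triangle (tang1 p0 p1 p2 c) p1 (tang2 p0 p1 p2 c) x /\
     r <= vnorm (vsub x o)).

(** Arc-length parametrised planar curve starting at [a] with initial unit
    tangent [u/|u|] and signed curvature [k s]: the tangent orientation
    turns by [turn k s = ∫_0^s k], the position is the integral of the
    unit tangent. *)
Definition turn (k : R -> R) (s : R) : R := RInt k 0 s.

Definition curve_pos (a u : pt) (k : R -> R) (s : R) : pt :=
  (fst a + RInt (fun t =>
       (fst u * cos (turn k t) - snd u * sin (turn k t)) / vnorm u) 0 s,
   snd a + RInt (fun t =>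
       (fst u * sin (turn k t) + snd u * cos (turn k t)) / vnorm u) 0 s).

Definition interpolates (p0 p1 p2 : pt) (c : option R) (beta : R)
    (a : pt) (k : R -> R) (L : R) : Prop :=
  0 <= L /\
  on_seg p0 p1 a /\
  on_seg p1 p2 (curve_pos a (vsub p1 p0) k L) /\
  turn k L = beta /\
  (forall s, 0 <= s <= L -> in_safe_zone p0 p1 p2 c (curve_pos a (vsub p1 p0) k s)).

Definition clothoid_pair_curv (k1 k2 d1 d2 sM sF : R) (s : R) : R :=
  if Rle_dec s sM then k1 + d1 * s else k2 + d2 * (sF - s).

Definition good_clothoid_pair (p0 p1 p2 : pt) (c : option R) (beta : R)
    (kC : R) (aC : pt) (LC : R) (k1 k2 : R) (prm : R * R * R * R) : Prop :=
  let '(d1, d2, sM, sF) := prm in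
  0 < sM < sF /\
  k1 + d1 * sM = k2 + d2 * (sF - sM) /\
  kC < k1 + d1 * sM /\
  interpolates p0 p1 p2 c beta aC (clothoid_pair_curv k1 k2 d1 d2 sM sF) sF /\
  curve_pos aC (vsub p1 p0) (clothoid_pair_curv k1 k2 d1 d2 sM sF) sF
    = curve_pos aC (vsub p1 p0) (fun _ => kC) LC.

(* Main.v *)
Require Import Defs.
From Stdlib Require Import Reals.
From Stdlib Require Import Lra List Psatz ClassicalEpsilon.
From Coquelicot Require Import Coquelicot.
Open Scope R_scope.

(** Along a clothoid the square of the curvature is an affine function of the tangent angle
    [x].  A pair of arcs is therefore a tent [q(x) = min (k1^2 + 2 d1 x, k2^2 + 2 d2 (beta - x))]
    on [[0, beta]], with arc length density [w = 1 / sqrt q], and closing up with the circle arc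
    means that [w] and [1 / kC] have the same integral against every sinusoid in [x].

    Uniqueness: two such tents with the same end values cross at most once in [(0, beta)], and
    since [beta < PI] some sinusoid has exactly the sign of the difference of the densities.

    Existence: for an apex at angle [b] the chord equation determines the apex curvature, which
    depends continuously on [b]; the remaining equation changes sign between [b = 0] and
    [b = beta].

    Safe zone: [w - 1 / kC] has signs [+ - +], which forces the support function of the curve to
    dominate that of the circle, so the curve stays between the circle and the two segments. *)

(** Curves of different lengths have no common arc length parameter, but the tangent angle runs over
    the same [[0, beta]] for all of them, so comparing curves reduces to comparing densities against
    the same weights. The four parameters face four scalar equations: equal curvatures at the joint,
    total turning [beta], and the two coordinates of the end point, which is that of the circle arc.
    Describing a pair by the angle [b] and the curvature [k] of its apex satisfies the first two
    automatically. The other two are split along and across the chord of the circle arc: along it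
    the weight is a cosine positive on [(0, beta)], so that equation is strictly monotone in [k];
    across it the weight is odd about [beta / 2], so a single arc can never satisfy it, and this
    yields the opposite signs at the two ends. The closing condition is invariant under rigid
    motions; this is why the parameters depend on four real numbers and not on the corner. *)

(** * Integrals of densities in the tangent angle *)

(* Coquelicot states equalities at the carrier of [R_CompleteNormedModule], which [ring] and
   [field] do not recognise. *)
Ltac as_R := match goal with |- @eq _ ?a ?b => change (@eq R a b) end.

(** [g] integrates to [I] on [[a, b]] through a primitive that may lack a derivative at the end
    points and at finitely many knots: the density of an arc of zero initial curvature blows up
    like [1 / sqrt x], so [g] need not be Riemann integrable. *)
Definition gint (g : R -> R) (a b I : R) : Prop :=
  exists (P : R -> R) (l : list R),
    (forall x, continuous P x) /\
    (forall x, a < x < b -> ~ In x l -> is_derive P x (g x)) /\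
    I = P b - P a.

(** Without exceptional points this is the mean value theorem. Each exceptional point inside the
    interval splits it in two, and the increments over the pieces add up. *)
Lemma increment_sign (P g : R -> R) (l : list R) (a b : R) :
  (forall x, continuous P x) ->
  (forall x, a < x < b -> ~ In x l -> is_derive P x (g x)) ->
  (a <= b -> (forall x, a < x < b -> 0 <= g x) -> P a <= P b) /\
  (a < b -> (forall x, a < x < b -> 0 < g x) -> P a < P b).
Proof.
  intros HP; revert a b; induction l as [|y l IH]; intros a b Hd.
  - assert (K : a < b -> exists c, a < c < b /\ P b - P a = g c * (b - a)).
    { intros Hab.
      assert (D : forall c, a < c < b -> derivable_pt P c).
      { intros c Hc; exists (g c); apply is_derive_Reals, Hd; auto. }
      destruct (MVT P id a b D (fun c _ => derivable_pt_id c) Hab) as (c & Hc & E).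
      - intros c _; apply continuity_pt_filterlim, HP.
      - intros c _; apply derivable_continuous_pt, derivable_pt_id.
      - exists c; split; [exact Hc|].
        rewrite (derive_pt_eq_0 _ _ _ (derivable_pt_id c) (derivable_pt_lim_id c)) in E.
        rewrite (derive_pt_eq_0 _ _ (g c) (D c Hc)) in E.
        + unfold id in E; lra.
        + apply is_derive_Reals, Hd; auto. }
    split; intros Hab Hg.
    + destruct (Rle_lt_or_eq_dec a b Hab) as [H|H].
      * destruct (K H) as (c & Hc & E); specialize (Hg c Hc); nra.
      * rewrite H; lra.
    + destruct (K Hab) as (c & Hc & E); specialize (Hg c Hc); nra.
  - destruct (Rlt_dec a y) as [H1|H1]; [destruct (Rlt_dec y b) as [H2|H2]|].
    + destruct (IH a y) as [A1 A2].
      { intros x Hx Hi; apply Hd; [lra|intros [->|K]; [lra|auto]]. }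
      destruct (IH y b) as [B1 B2].
      { intros x Hx Hi; apply Hd; [lra|intros [->|K]; [lra|auto]]. }
      split; intros Hab Hg.
      * apply Rle_trans with (P y); [apply A1|apply B1]; try lra; intros; apply Hg; lra.
      * apply Rlt_trans with (P y); [apply A2|apply B2]; try lra; intros; apply Hg; lra.
    + apply IH; intros x Hx Hi; apply Hd; [lra|intros [->|K]; [lra|auto]].
    + apply IH; intros x Hx Hi; apply Hd; [lra|intros [->|K]; [lra|auto]].
Qed.

Lemma gint_nonneg g a b I :
  a <= b -> (forall x, a < x < b -> 0 <= g x) -> gint g a b I -> 0 <= I.
Proof.
  intros Hab Hg (P & l & HP & Hd & ->).
  destruct (increment_sign P g l a b HP Hd) as [H _]; specialize (H Hab Hg); lra.
Qed.

Lemma gint_pos g a b I :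
  a < b -> (forall x, a < x < b -> 0 < g x) -> gint g a b I -> 0 < I.
Proof.
  intros Hab Hg (P & l & HP & Hd & ->).
  destruct (increment_sign P g l a b HP Hd) as [_ H]; specialize (H Hab Hg); lra.
Qed.

(** The integrands compared later vanish where densities cross or a sinusoid changes sign, so
    strictness is available on a subinterval only. *)
Lemma gint_pos_sub g a b a' b' I :
  a <= a' -> a' < b' -> b' <= b ->
  (forall x, a < x < b -> 0 <= g x) -> (forall x, a' < x < b' -> 0 < g x) ->
  gint g a b I -> 0 < I.
Proof.
  intros Ha Hab Hb Hg Hg' (P & l & HP & Hd & ->).
  assert (H1 : 0 <= P a' - P a).
  { apply (gint_nonneg g a a'); [lra|intros; apply Hg; lra|].
    exists P, l; split; [|split]; auto; intros; apply Hd; auto; lra. }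
  assert (H2 : 0 < P b' - P a').
  { apply (gint_pos g a' b'); [lra|intros; apply Hg'; lra|].
    exists P, l; split; [|split]; auto; intros; apply Hd; auto; lra. }
  assert (H3 : 0 <= P b - P b').
  { apply (gint_nonneg g b' b); [lra|intros; apply Hg; lra|].
    exists P, l; split; [|split]; auto; intros; apply Hd; auto; lra. }
  lra.
Qed.

Lemma gint_ext g h a b I :
  (forall x, a < x < b -> g x = h x) -> gint g a b I -> gint h a b I.
Proof.
  intros E (P & l & HP & Hd & ->); exists P, l; split; [|split]; auto.
  intros x Hx Hi; rewrite <- E by auto; auto.
Qed.

Lemma gint_minus g h a b I J :
  gint g a b I -> gint h a b J -> gint (fun x => g x - h x) a b (I - J).
Proof.
  intros (P & l & HP & Hd & ->) (Q & m & HQ & He & ->).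
  exists (fun x => P x - Q x), (l ++ m); split; [|split].
  - intros x; apply (continuous_minus P Q); auto.
  - intros x Hx Hi; rewrite in_app_iff in Hi.
    apply (is_derive_minus P Q); [apply Hd|apply He]; tauto.
  - ring.
Qed.

Lemma gint_opp g a b I : gint g a b I -> gint (fun x => - g x) a b (- I).
Proof.
  intros (P & l & HP & Hd & ->).
  exists (fun x => - P x), l; split; [|split]; [| |ring].
  - intros x; apply (continuous_opp P); auto.
  - intros x Hx Hi; apply (is_derive_opp P); auto.
Qed.

Lemma gint_unique g a b I J : a <= b -> gint g a b I -> gint g a b J -> I = J.
Proof.
  intros Hab H1 H2.
  assert (A := gint_nonneg _ _ _ _ Hab (fun x _ => Req_le _ _ (eq_sym (Rminus_diag (g x)))) (gint_minus _ _ _ _ _ _ H1 H2)).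
  assert (B := gint_nonneg _ _ _ _ Hab (fun x _ => Req_le _ _ (eq_sym (Rminus_diag (g x)))) (gint_minus _ _ _ _ _ _ H2 H1)).
  lra.
Qed.

Lemma gint_tail g a b c I J :
  a <= b <= c -> gint g a c I -> gint g a b J -> gint g b c (I - J).
Proof.
  intros Hab (P & l & HP & Hd & ->) H.
  assert (E : J = P b - P a).
  { apply (gint_unique g a b); auto; [lra|].
    exists P, l; split; [|split]; auto; intros; apply Hd; auto; lra. }
  exists P, l; split; [|split]; auto.
  - intros; apply Hd; auto; lra.
  - rewrite E; ring.
Qed.

Lemma is_derive_continuous (f : R -> R) (x l : R) : is_derive f x l -> continuous f x.
Proof. intros H; apply (ex_derive_continuous f); exists l; exact H. Qed.

Lemma continuous_Rmin_l (b x : R) : continuous (fun y => Rmin y b) x.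
Proof.
  apply (continuous_ext (fun y => (y + b - Rabs (y - b)) / 2)).
  { intros y; unfold Rmin, Rabs; destruct Rle_dec, Rcase_abs; lra. }
  apply (continuous_scal_l (fun y => y + b - Rabs (y - b)) (/ 2)).
  apply (continuous_minus (fun y => y + b)).
  - apply (is_derive_continuous _ x 1); auto_derive; auto.
  - apply (continuous_comp (fun y => y - b) Rabs); [|apply continuous_Rabs].
    apply (is_derive_continuous _ x 1); auto_derive; auto.
Qed.

Lemma continuous_Rmax_l (b x : R) : continuous (fun y => Rmax y b) x.
Proof.
  apply (continuous_ext (fun y => y + b - Rmin y b)).
  { intros y; unfold Rmin, Rmax; destruct Rle_dec; as_R; ring. }
  apply (continuous_minus (fun y => y + b)); [|apply continuous_Rmin_l].
  apply (is_derive_continuous _ x 1); auto_derive; auto.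
Qed.

Lemma gint_chasles g a b c I J :
  a <= b <= c -> gint g a b I -> gint g b c J -> gint g a c (I + J).
Proof.
  intros Hb (P & l & HP & Hd & ->) (Q & m & HQ & He & ->).
  (* The glued primitive is [P (min x b) + Q (max x b) - Q b]. *)
  exists (fun x => P (Rmin x b) + (Q (Rmax x b) - Q b)), (b :: l ++ m); split; [|split].
  - intros x; apply (continuous_plus (fun x => P (Rmin x b)) (fun x => Q (Rmax x b) - Q b)).
    + apply (continuous_comp (fun x => Rmin x b) P); [|apply HP].
      apply continuous_Rmin_l.
    + apply (continuous_minus (fun x => Q (Rmax x b)) (fun _ => Q b)); [|apply continuous_const].
      apply (continuous_comp (fun x => Rmax x b) Q); [|apply HQ].
      apply continuous_Rmax_l.
  - intros x Hx Hi; simpl in Hi; rewrite in_app_iff in Hi.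
    destruct (Rtotal_order x b) as [H|[H|H]]; [|subst; tauto|].
    + apply is_derive_ext_loc with P; [|apply Hd; [lra|tauto]].
      assert (Hp : 0 < b - x) by lra.
      exists (mkposreal _ Hp); intros y Hy.
      apply Rabs_def2 in Hy; simpl in Hy; unfold minus, plus, opp in Hy; simpl in Hy.
      rewrite Rmin_left, Rmax_right by lra; as_R; ring.
    + apply is_derive_ext_loc with (fun y => P b - Q b + Q y).
      { assert (Hp : 0 < x - b) by lra.
        exists (mkposreal _ Hp); intros y Hy.
        apply Rabs_def2 in Hy; simpl in Hy; unfold minus, plus, opp in Hy; simpl in Hy.
        rewrite Rmin_right, Rmax_left by lra; as_R; ring. }
      replace (g x) with (plus 0 (g x)) by apply Rplus_0_l.
      apply (is_derive_plus (fun _ => P b - Q b) Q); [apply is_derive_Reals, derivable_pt_lim_const|].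
      apply He; [lra|tauto].
  - rewrite (Rmin_right c b), (Rmax_left c b), (Rmin_left a b), (Rmax_right a b) by lra; as_R; ring.
Qed.

(** * Riemann integrals of continuous functions: primitives, substitution, sinusoids *)

Lemma continuous_ex_RInt (f : R -> R) (a b : R) : (forall x, continuous f x) -> ex_RInt f a b.
Proof. intros Hf; apply (ex_RInt_continuous (V := R_CompleteNormedModule) f); auto. Qed.

Lemma is_derive_primitive (f : R -> R) (a x : R) :
  (forall y, continuous f y) -> is_derive (RInt f a) x (f x).
Proof.
  intros Hf; apply (is_derive_RInt f (RInt f a) a x); [|apply Hf].
  apply filter_forall; intros y; apply (RInt_correct (V := R_CompleteNormedModule) f), continuous_ex_RInt, Hf.
Qed.

Lemma gint_RInt (f : R -> R) (r a b : R) :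
  (forall x, continuous f x) -> gint (fun x => f x * r) a b (r * RInt f a b).
Proof.
  intros Hf; exists (fun x => r * RInt f a x), nil.
  assert (D : forall x, is_derive (fun x => r * RInt f a x) x (f x * r)).
  { intros x; rewrite Rmult_comm; apply (is_derive_scal (RInt f a) x r), is_derive_primitive, Hf. }
  split; [|split]; auto.
  - intros x; eapply is_derive_continuous, D.
  - rewrite (RInt_point a f); change zero with 0; as_R; ring.
Qed.

(** Passage from arc length to tangent angle: [l] gives the length at a given angle, [T] the angle
    at a given length, and [w] is the density. The derivative of [l] is asked for in the open
    interval only, so [w] may blow up at its ends. *)
Lemma gint_subst (f T l w : R -> R) (a b : R) :
  (forall x, continuous f x) -> (forall x, continuous T x) -> (forall x, continuous l x) ->
  (forall x, a < x < b -> is_derive l x (w x) /\ T (l x) = x) ->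
  gint (fun x => f x * w x) a b (RInt (fun s => f (T s)) (l a) (l b)).
Proof.
  intros Hf HT Hl H.
  assert (Hc : forall x, continuous (fun s => f (T s)) x)
    by (intros x; apply (continuous_comp T f); auto).
  assert (D := fun x => is_derive_primitive _ (l a) x Hc).
  exists (fun x => RInt (fun s => f (T s)) (l a) (l x)), nil; split; [|split].
  - intros x; apply (continuous_comp l (RInt (fun s => f (T s)) (l a))); auto.
    eapply is_derive_continuous, D.
  - intros x Hx _; destruct (H x Hx) as [H1 H2].
    replace (f x * w x) with (scal (w x) (f (T (l x)))).
    + apply (is_derive_comp (RInt (fun s => f (T s)) (l a)) l); auto.
    + rewrite H2; apply Rmult_comm.
  - rewrite RInt_point; change zero with 0; as_R; lra.
Qed.

Lemma RInt_lin (f g : R -> R) (u v a b : R) :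
  (forall x, continuous f x) -> (forall x, continuous g x) ->
  RInt (fun x => u * f x + v * g x) a b = u * RInt f a b + v * RInt g a b.
Proof.
  intros Hf Hg; apply is_RInt_unique.
  apply (is_RInt_plus (fun x => u * f x) (fun x => v * g x)).
  - apply (is_RInt_scal f a b u), (RInt_correct (V := R_CompleteNormedModule) f), continuous_ex_RInt, Hf.
  - apply (is_RInt_scal g a b v), (RInt_correct (V := R_CompleteNormedModule) g), continuous_ex_RInt, Hg.
Qed.

Lemma RInt_split (f : R -> R) (a b c : R) :
  (forall x, continuous f x) -> RInt f a c = RInt f a b + RInt f b c.
Proof. intros Hf; symmetry; apply (RInt_Chasles f); apply continuous_ex_RInt, Hf. Qed.

Lemma RInt_affine (f : R -> R) (u v a b : R) :
  (forall x, continuous f x) ->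
  u * RInt (fun y => f (u * y + v)) a b = RInt f (u * a + v) (u * b + v).
Proof.
  intros Hf; rewrite <- (RInt_comp_lin f u v a b) by (apply continuous_ex_RInt, Hf).
  symmetry; apply (RInt_scal (fun y => f (u * y + v))), continuous_ex_RInt; intros x.
  apply (continuous_comp (fun y => u * y + v) f); [|apply Hf].
  apply (is_derive_continuous _ x u); auto_derive; auto; ring.
Qed.

Lemma continuous_sin_affine (u v x : R) : continuous (fun y => sin (u * y + v)) x.
Proof. apply (is_derive_continuous _ x (u * cos (u * x + v))); auto_derive; auto; ring. Qed.

Lemma continuous_cos_affine (u v x : R) : continuous (fun y => cos (u * y + v)) x.
Proof. apply (is_derive_continuous _ x (- u * sin (u * x + v))); auto_derive; auto; ring. Qed.

Lemma RInt_sin_affine (u v a b : R) :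
  u <> 0 -> RInt (fun y => sin (u * y + v)) a b = (cos (u * a + v) - cos (u * b + v)) / u.
Proof.
  intros Hu; apply is_RInt_unique.
  replace ((cos (u * a + v) - cos (u * b + v)) / u)
    with (minus (- cos (u * b + v) / u) (- cos (u * a + v) / u))
    by (unfold minus, plus, opp; simpl; field; auto).
  apply (is_RInt_derive (fun y => - cos (u * y + v) / u)); intros x _.
  - auto_derive; auto; field; auto.
  - apply continuous_sin_affine.
Qed.

Lemma RInt_cos_affine (u v a b : R) :
  u <> 0 -> RInt (fun y => cos (u * y + v)) a b = (sin (u * b + v) - sin (u * a + v)) / u.
Proof.
  intros Hu; apply is_RInt_unique.
  replace ((sin (u * b + v) - sin (u * a + v)) / u)
    with (minus (sin (u * b + v) / u) (sin (u * a + v) / u))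
    by (unfold minus, plus, opp; simpl; field; auto).
  apply (is_RInt_derive (fun y => sin (u * y + v) / u)); intros x _.
  - auto_derive; auto; field; auto.
  - apply continuous_cos_affine.
Qed.

(** * Tents *)

(** The convention that [sqrt] is 0 on negative reals makes it continuous on the whole line, as the
    primitives in [gint] have to be. *)
Lemma continuous_sqrt_everywhere (x : R) : continuous sqrt x.
Proof.
  destruct (Rle_lt_dec 0 x) as [H|H].
  - apply continuity_pt_filterlim, continuity_pt_sqrt, H.
  - apply (continuous_ext_loc _ (fun _ : R => 0)); [|apply continuous_const].
    assert (Hp : 0 < - x) by lra.
    exists (mkposreal _ Hp); intros y Hy.
    apply Rabs_def2 in Hy; simpl in Hy; unfold minus, plus, opp in Hy; simpl in Hy.
    rewrite sqrt_neg_0 by lra; reflexivity.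
Qed.

(** The quadratic is the angle turned along an arc of initial curvature [k] and rate [d]. *)
Lemma quad_le (k d a b : R) :
  0 <= k -> 0 < d -> 0 <= a <= b -> k * a + d * a ^ 2 / 2 <= k * b + d * b ^ 2 / 2.
Proof.
  intros Hk Hd Hab.
  assert (k * a <= k * b) by (apply Rmult_le_compat_l; lra).
  assert (d * a ^ 2 <= d * b ^ 2) by (apply Rmult_le_compat_l, pow_incr; lra).
  lra.
Qed.

(** Arc length at which an arc of initial curvature [k0] and rate [d] has turned by [x]. *)
Definition arc_len (k0 d x : R) : R := (sqrt (k0 ^ 2 + 2 * d * x) - k0) / d.

Lemma arc_len_turn (k0 d x : R) :
  0 < d -> 0 <= k0 ^ 2 + 2 * d * x ->
  k0 * arc_len k0 d x + d * arc_len k0 d x ^ 2 / 2 = x.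
Proof.
  intros Hd H; unfold arc_len.
  assert (E := sqrt_sqrt _ H); set (q := sqrt _) in *.
  replace (_ + _) with ((q * q - k0 ^ 2) / (2 * d)) by (field; lra).
  rewrite E; field; lra.
Qed.

Lemma turn_arc_len (k0 d s : R) :
  0 <= k0 -> 0 < d -> 0 <= s -> arc_len k0 d (k0 * s + d * s ^ 2 / 2) = s.
Proof.
  intros Hk Hd Hs; unfold arc_len.
  replace (k0 ^ 2 + _) with ((k0 + d * s) ^ 2) by field.
  rewrite sqrt_pow2 by nra; field; lra.
Qed.

Lemma is_derive_arc_len (k0 d x : R) :
  0 < d -> 0 < k0 ^ 2 + 2 * d * x ->
  is_derive (arc_len k0 d) x (/ sqrt (k0 ^ 2 + 2 * d * x)).
Proof.
  intros Hd H; unfold arc_len; assert (Hs := sqrt_lt_R0 _ H).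
  auto_derive.
  - simpl in *; lra.
  - change (k0 * (k0 * 1)) with (k0 ^ 2); field; lra.
Qed.

Lemma continuous_arc_len (k0 d x : R) : continuous (arc_len k0 d) x.
Proof.
  apply (continuous_scal_l (fun y => sqrt (k0 ^ 2 + 2 * d * y) - k0) (/ d)).
  apply (continuous_minus (fun y => sqrt (k0 ^ 2 + 2 * d * y))); [|apply continuous_const].
  apply (continuous_comp (fun y => k0 ^ 2 + 2 * d * y) sqrt); [|apply continuous_sqrt_everywhere].
  apply (is_derive_continuous _ x (2 * d)); auto_derive; auto; ring.
Qed.

Lemma gint_arc (f : R -> R) (k0 d s : R) :
  (forall x, continuous f x) -> 0 <= k0 -> 0 < d -> 0 <= s ->
  gint (fun x => f x * / sqrt (k0 ^ 2 + 2 * d * x)) 0 (k0 * s + d * s ^ 2 / 2)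
    (RInt (fun t => f (k0 * t + d * t ^ 2 / 2)) 0 s).
Proof.
  intros Hf Hk Hd Hs.
  assert (E0 : arc_len k0 d 0 = 0).
  { assert (E := turn_arc_len k0 d 0 Hk Hd (Rle_refl 0)); rewrite <- E at 2; f_equal; field. }
  assert (G := gint_subst f (fun t => k0 * t + d * t ^ 2 / 2) (arc_len k0 d)
    (fun x => / sqrt (k0 ^ 2 + 2 * d * x)) 0 (k0 * s + d * s ^ 2 / 2)).
  rewrite E0, turn_arc_len in G by auto; apply G; auto.
  - intros x; apply (is_derive_continuous _ x (k0 + d * x)); auto_derive; auto; field.
  - apply continuous_arc_len.
  - intros x Hx; assert (0 < k0 ^ 2 + 2 * d * x) by (assert (0 < d * x) by nra; nra).
    split; [apply is_derive_arc_len|apply arc_len_turn]; lra.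
Qed.

(** Read backwards from its end, the second arc again has growing curvature. [T] and [S] are the
    angle and the arc length at that end, from which [T - x] and [S - t] are measured. *)
Lemma gint_arc_rev (f : R -> R) (k0 d T S s s' : R) :
  (forall x, continuous f x) -> 0 <= k0 -> 0 < d -> s <= s' <= S ->
  gint (fun x => f x * / sqrt (k0 ^ 2 + 2 * d * (T - x)))
    (T - (k0 * (S - s) + d * (S - s) ^ 2 / 2)) (T - (k0 * (S - s') + d * (S - s') ^ 2 / 2))
    (RInt (fun t => f (T - (k0 * (S - t) + d * (S - t) ^ 2 / 2))) s s').
Proof.
  intros Hf Hk Hd Hs'.
  assert (E : forall r, r <= S -> S - arc_len k0 d (T - (T - (k0 * (S - r) + d * (S - r) ^ 2 / 2))) = r).
  { intros r Hr; replace (T - _) with (k0 * (S - r) + d * (S - r) ^ 2 / 2) by ring.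
    rewrite turn_arc_len by lra; ring. }
  assert (G := gint_subst f (fun t => T - (k0 * (S - t) + d * (S - t) ^ 2 / 2))
    (fun x => S - arc_len k0 d (T - x)) (fun x => / sqrt (k0 ^ 2 + 2 * d * (T - x)))
    (T - (k0 * (S - s) + d * (S - s) ^ 2 / 2)) (T - (k0 * (S - s') + d * (S - s') ^ 2 / 2))).
  cbv beta in G; rewrite (E s), (E s') in G by lra; apply G; auto.
  - intros x; apply (is_derive_continuous _ x (k0 + d * (S - x))); auto_derive; auto; field.
  - intros x; apply (continuous_minus (fun _ => S)); [apply continuous_const|].
    apply (continuous_comp (fun x => T - x) (arc_len k0 d)); [|apply continuous_arc_len].
    apply (is_derive_continuous _ x (-1)); auto_derive; auto.
  - intros x Hx.
    assert (Hx' : 0 < T - x).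
    { assert (Q := quad_le k0 d 0 (S - s') Hk Hd ltac:(lra)); lra. }
    assert (0 < k0 ^ 2 + 2 * d * (T - x)) by (assert (0 < d * (T - x)) by nra; nra).
    split.
    + replace (/ _) with (0 - (-1) * / sqrt (k0 ^ 2 + 2 * d * (T - x))) by ring.
      apply (is_derive_minus (fun _ => S)); [apply is_derive_Reals, derivable_pt_lim_const|].
      apply (is_derive_comp (arc_len k0 d) (fun x => T - x)).
      * apply is_derive_arc_len; lra.
      * auto_derive; auto.
    + replace (S - (S - arc_len k0 d (T - x))) with (arc_len k0 d (T - x)) by ring.
      rewrite arc_len_turn; lra.
Qed.

Definition tent (k1 k2 beta d1 d2 sM sF : R) : Prop :=
  0 <= k1 /\ 0 <= k2 /\ 0 < d1 /\ 0 < d2 /\ 0 < sM < sF /\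
  k1 + d1 * sM = k2 + d2 * (sF - sM) /\
  turn (clothoid_pair_curv k1 k2 d1 d2 sM sF) sF = beta.

Section Clothoid.
Variables k1 k2 d1 d2 sM sF : R.
Hypothesis HsM : 0 < sM < sF.
Hypothesis Hjoin : k1 + d1 * sM = k2 + d2 * (sF - sM).
Notation K := (clothoid_pair_curv k1 k2 d1 d2 sM sF).

Lemma clothoid_continuous (x : R) : continuous K x.
Proof.
  (* A branch-free form of the curvature; it agrees with the second branch because of the joint
     condition [Hjoin]. *)
  apply (continuous_ext (fun x => (k1 + d1 * Rmin x sM) - d2 * (Rmax x sM - sM))).
  { intros y; unfold clothoid_pair_curv; destruct Rle_dec as [H|H]; as_R.
    - rewrite Rmin_left, Rmax_right by lra; ring.
    - rewrite Rmin_right, Rmax_left by lra; rewrite Hjoin; ring. }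
  apply (continuous_minus (fun x => k1 + d1 * Rmin x sM)).
  - apply (continuous_plus (fun _ => k1)); [apply continuous_const|].
    apply (continuous_scal_r (V := R_NormedModule) d1 (fun x => Rmin x sM)), continuous_Rmin_l.
  - apply (continuous_scal_r (V := R_NormedModule) d2 (fun x => Rmax x sM - sM)).
    apply (continuous_minus (fun x => Rmax x sM)); [apply continuous_Rmax_l|apply continuous_const].
Qed.

Lemma continuous_turn (x : R) : continuous (turn K) x.
Proof. eapply is_derive_continuous, (is_derive_primitive K 0), clothoid_continuous. Qed.

Lemma continuous_turn_comp (f : R -> R) :
  (forall x, continuous f x) -> forall x, continuous (fun s => f (turn K s)) x.
Proof. intros Hf x; apply (continuous_comp (turn K) f); [apply continuous_turn|apply Hf]. Qed.

Lemma turn_first (s : R) : s <= sM -> turn K s = k1 * s + d1 * s ^ 2 / 2.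
Proof.
  intros Hs; unfold turn.
  rewrite (RInt_ext K (fun t => k1 + d1 * t)).
  - apply is_RInt_unique.
    replace (k1 * s + _) with (minus (k1 * s + d1 * s ^ 2 / 2) (k1 * 0 + d1 * 0 ^ 2 / 2))
      by (unfold minus, plus, opp; simpl; field).
    apply (is_RInt_derive (fun s => k1 * s + d1 * s ^ 2 / 2)); intros x _.
    + auto_derive; auto; field.
    + apply (is_derive_continuous _ x d1); auto_derive; auto; ring.
  - intros x Hx; unfold clothoid_pair_curv; destruct Rle_dec as [H|H]; auto.
    exfalso; apply H; destruct Hx as [_ Hx]; unfold Rmax in Hx; destruct Rle_dec; lra.
Qed.

Lemma turn_second (s : R) : sM <= s ->
  turn K s = turn K sF - (k2 * (sF - s) + d2 * (sF - s) ^ 2 / 2).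
Proof.
  intros Hs; unfold turn.
  assert (E : RInt K s sF = k2 * (sF - s) + d2 * (sF - s) ^ 2 / 2).
  - rewrite (RInt_ext K (fun t => k2 + d2 * (sF - t))).
    + apply is_RInt_unique.
      replace (k2 * (sF - s) + _)
        with (minus (- (k2 * (sF - sF) + d2 * (sF - sF) ^ 2 / 2)) (- (k2 * (sF - s) + d2 * (sF - s) ^ 2 / 2)))
        by (unfold minus, plus, opp; simpl; field).
      apply (is_RInt_derive (fun s => - (k2 * (sF - s) + d2 * (sF - s) ^ 2 / 2))); intros x _.
      * auto_derive; auto; field.
      * apply (is_derive_continuous _ x (- d2)); auto_derive; auto; ring.
    + intros x Hx; unfold clothoid_pair_curv; destruct Rle_dec as [H|H]; auto.
      exfalso; destruct Hx as [Hx _]; unfold Rmin in Hx; destruct Rle_dec; lra.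
  - rewrite (RInt_split K 0 s sF) by apply clothoid_continuous; lra.
Qed.
End Clothoid.

(** [ds/dx] as a function of the tangent angle [x]. *)
Definition dens (k1 k2 beta d1 d2 x : R) : R :=
  / sqrt (Rmin (k1 ^ 2 + 2 * d1 * x) (k2 ^ 2 + 2 * d2 * (beta - x))).

Section Tent.
Variables k1 k2 beta d1 d2 sM sF : R.
Hypothesis HT : tent k1 k2 beta d1 d2 sM sF.
Notation T := (turn (clothoid_pair_curv k1 k2 d1 d2 sM sF)).

(** Both sides of the tent reach the squared joint curvature at the angle [T sM]. As one side rises
    and the other falls, this angle decides which of them [Rmin] selects. *)
Lemma tent_apex : k1 ^ 2 + 2 * d1 * T sM = (k1 + d1 * sM) ^ 2 /\
  k2 ^ 2 + 2 * d2 * (beta - T sM) = (k1 + d1 * sM) ^ 2.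
Proof.
  destruct HT as (_ & _ & _ & _ & HM & Hj & Hb); split.
  - rewrite turn_first by lra; field.
  - rewrite (turn_second _ _ _ _ _ _ HM Hj), Hb, Hj by lra; field.
Qed.

Lemma tent_turn_bounds (s : R) : 0 <= s <= sF -> 0 <= T s <= beta.
Proof.
  intros Hs; destruct HT as (H1 & H2 & Hd1 & Hd2 & HM & Hj & Hb).
  assert (E := fun s => turn_second k1 k2 d1 d2 sM sF HM Hj s).
  assert (M : 0 <= T sM <= beta).
  { split.
    - rewrite turn_first by lra; assert (Q := quad_le k1 d1 0 sM); lra.
    - rewrite E, Hb by lra; assert (Q := quad_le k2 d2 0 (sF - sM)); lra. }
  destruct (Rle_lt_dec s sM) as [H|H].
  - rewrite (turn_first _ _ _ _ _ _ HM s H); rewrite (turn_first _ _ _ _ _ _ HM sM) in M by lra.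
    assert (Q := quad_le k1 d1 0 s); assert (Q' := quad_le k1 d1 s sM); lra.
  - rewrite (E s), Hb by lra; rewrite (E sM), Hb in M by lra.
    assert (Q := quad_le k2 d2 0 (sF - s)); assert (Q' := quad_le k2 d2 (sF - s) (sF - sM)); lra.
Qed.

(** Up to the apex this is the substitution along the first arc; beyond it, the backward
    substitution along the second arc is glued on at [T sM]. *)
Lemma tent_gint (f : R -> R) (s : R) :
  (forall x, continuous f x) -> 0 <= s <= sF ->
  gint (fun x => f x * dens k1 k2 beta d1 d2 x) 0 (T s) (RInt (fun t => f (T t)) 0 s).
Proof.
  intros Hf Hs; destruct HT as (H1 & H2 & Hd1 & Hd2 & HM & Hj & Hb).
  destruct tent_apex as [A1 A2].
  assert (First : forall s, 0 <= s <= sM ->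
    gint (fun x => f x * dens k1 k2 beta d1 d2 x) 0 (T s) (RInt (fun t => f (T t)) 0 s)).
  { intros r Hr.
    rewrite turn_first by lra.
    rewrite (RInt_ext _ (fun t => f (k1 * t + d1 * t ^ 2 / 2))).
    2: { intros x; rewrite Rmin_left, Rmax_right by lra; intros Hx; rewrite turn_first by lra; auto. }
    eapply gint_ext, gint_arc; auto; [|lra].
    intros x Hx; unfold dens; rewrite Rmin_left; auto.
    assert (x <= T sM).
    { rewrite turn_first by lra; assert (Q := quad_le k1 d1 r sM); lra. }
    assert (d1 * x <= d1 * T sM) by nra. assert (d2 * x <= d2 * T sM) by nra. lra. }
  destruct (Rle_lt_dec s sM) as [H|H]; [apply First; lra|].
  rewrite (RInt_split _ 0 sM s) by (apply continuous_turn_comp; auto).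
  apply gint_chasles with (T sM); [|apply First; lra|].
  - split; [apply tent_turn_bounds; lra|].
    rewrite (turn_second _ _ _ _ _ _ HM Hj s), (turn_second _ _ _ _ _ _ HM Hj sM) by lra.
    assert (Q := quad_le k2 d2 (sF - s) (sF - sM)); lra.
  - rewrite (RInt_ext _ (fun t => f (beta - (k2 * (sF - t) + d2 * (sF - t) ^ 2 / 2)))).
    2: { intros x; rewrite Rmin_left, Rmax_right by lra; intros Hx.
         rewrite (turn_second _ _ _ _ _ _ HM Hj), Hb by lra; auto. }
    assert (E : forall s, sM <= s -> T s = beta - (k2 * (sF - s) + d2 * (sF - s) ^ 2 / 2)).
    { intros r Hr; rewrite (turn_second _ _ _ _ _ _ HM Hj), Hb by lra; auto. }
    rewrite (E s), (E sM) by lra.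
    eapply gint_ext, (gint_arc_rev f k2 d2 beta sF sM); auto; try lra.
    intros x Hx; rewrite <- E in Hx by lra; unfold dens; rewrite Rmin_right; auto.
    assert (d1 * T sM <= d1 * x) by nra. assert (d2 * T sM <= d2 * x) by nra. lra.
Qed.
End Tent.

(** * Uniqueness *)

Lemma inv_sqrt_lt (p q : R) : 0 < p < q -> / sqrt q < / sqrt p.
Proof.
  intros H; apply Rinv_lt_contravar; [|apply sqrt_lt_1; lra].
  apply Rmult_lt_0_compat; apply sqrt_lt_R0; lra.
Qed.

Lemma inv_sqrt_le (p q : R) : 0 < p <= q -> / sqrt q <= / sqrt p.
Proof. intros H; apply Rinv_le_contravar; [apply sqrt_lt_R0|apply sqrt_le_1]; lra. Qed.

Lemma Rmin_pos_dens (k1 k2 beta d1 d2 x : R) :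
  0 < d1 -> 0 < d2 -> 0 < x < beta ->
  0 < Rmin (k1 ^ 2 + 2 * d1 * x) (k2 ^ 2 + 2 * d2 * (beta - x)).
Proof.
  intros H1 H2 Hx; apply Rmin_glb_lt.
  - assert (0 < d1 * x) by (apply Rmult_lt_0_compat; lra). assert (P := pow2_ge_0 k1); lra.
  - assert (0 < d2 * (beta - x)) by (apply Rmult_lt_0_compat; lra). assert (P := pow2_ge_0 k2); lra.
Qed.

Lemma tent_gint_total (k1 k2 beta d1 d2 sM sF : R) (f : R -> R) :
  tent k1 k2 beta d1 d2 sM sF -> (forall x, continuous f x) ->
  gint (fun x => f x * dens k1 k2 beta d1 d2 x) 0 beta
    (RInt (fun t => f (turn (clothoid_pair_curv k1 k2 d1 d2 sM sF) t)) 0 sF).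
Proof.
  intros H Hf; assert (G := tent_gint _ _ _ _ _ _ _ H f sF Hf).
  destruct H as (_ & _ & _ & _ & HM & _ & Hb); rewrite Hb in G; apply G; lra.
Qed.

Lemma tent_apex_interior (k1 k2 beta d1 d2 sM sF : R) :
  tent k1 k2 beta d1 d2 sM sF ->
  0 < turn (clothoid_pair_curv k1 k2 d1 d2 sM sF) sM < beta.
Proof.
  intros H; destruct (tent_apex _ _ _ _ _ _ _ H) as [A1 A2].
  destruct H as (H1 & H2 & Hd1 & Hd2 & HM & Hj & Hb).
  assert (0 < d1 * sM) by (apply Rmult_lt_0_compat; lra).
  assert (0 < d2 * (sF - sM)) by (apply Rmult_lt_0_compat; lra).
  split; nra.
Qed.

Section Compare.
Variables k1 k2 beta d1 d2 sM sF d1' d2' sM' sF' : R.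
Hypothesis HT : tent k1 k2 beta d1 d2 sM sF.
Hypothesis HT' : tent k1 k2 beta d1' d2' sM' sF'.
Notation T := (turn (clothoid_pair_curv k1 k2 d1 d2 sM sF)).
Notation T' := (turn (clothoid_pair_curv k1 k2 d1' d2' sM' sF')).
Hypothesis Hbeta : beta < PI.
Hypothesis Heq : forall v, RInt (fun t => sin (T t + v)) 0 sF = RInt (fun t => sin (T' t + v)) 0 sF'.

Lemma continuous_sin_shift (v x : R) : continuous (fun y => sin (y + v)) x.
Proof. apply (is_derive_continuous _ x (cos (x + v))); auto_derive; auto; ring. Qed.

Lemma dens_diff_gint (v : R) :
  gint (fun x => sin (x + v) * (dens k1 k2 beta d1' d2' x - dens k1 k2 beta d1 d2 x)) 0 beta 0.
Proof.
  assert (C := continuous_sin_shift v).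
  assert (G := gint_minus _ _ _ _ _ _ (tent_gint_total _ _ _ _ _ _ _ _ HT' C)
    (tent_gint_total _ _ _ _ _ _ _ _ HT C)).
  cbv beta in G; rewrite Heq in G; rewrite Rminus_diag in G.
  eapply gint_ext, G; intros; simpl; ring.
Qed.

(* The density of the steeper tent is everywhere smaller, so the chords cannot agree. *)
Lemma compare_ordered : d1' <= d1 -> d2' <= d2 -> d1' < d1 \/ d2' < d2 -> False.
Proof.
  intros H1 H2 Hstrict.
  assert (B' := tent_apex_interior _ _ _ _ _ _ _ HT').
  destruct (tent_apex _ _ _ _ _ _ _ HT') as [A1 A2].
  set (b := T' sM') in *.
  destruct HT as (K1 & K2 & D1 & D2 & _); destruct HT' as (_ & _ & D1' & D2' & _).
  (* This phase centres [(0, beta)] inside [(0, PI)], so the sine is positive throughout. *)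
  assert (G := dens_diff_gint ((PI - beta) / 2)).
  assert (Hsin : forall x, 0 < x < beta -> 0 < sin (x + (PI - beta) / 2)) by (intros; apply sin_gt_0; lra).
  assert (Hle : forall x, 0 < x < beta -> 0 <= sin (x + (PI - beta) / 2) *
     (dens k1 k2 beta d1' d2' x - dens k1 k2 beta d1 d2 x)).
  { intros x Hx; apply Rmult_le_pos; [left; apply Hsin, Hx|].
    cut (dens k1 k2 beta d1 d2 x <= dens k1 k2 beta d1' d2' x); [lra|].
    apply inv_sqrt_le; split; [apply Rmin_pos_dens; lra|].
    assert (d1' * x <= d1 * x) by (apply Rmult_le_compat_r; lra).
    assert (d2' * (beta - x) <= d2 * (beta - x)) by (apply Rmult_le_compat_r; lra).
    apply Rmin_glb; [eapply Rle_trans; [apply Rmin_l|]|eapply Rle_trans; [apply Rmin_r|]]; lra. }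
  cut (0 < 0); [lra|].
  (* Before its apex [b] the primed tent is on its rising side, strictly below its falling side, so
     [d1' < d1] makes the inequality strict on [(0, b)]. Likewise [d2' < d2] makes it strict on
     [(b, beta)]. *)
  destruct Hstrict as [Hs|Hs].
  - apply (gint_pos_sub _ 0 beta 0 b _ ltac:(lra) ltac:(lra) ltac:(lra) Hle) in G; auto.
    intros x Hx; apply Rmult_lt_0_compat; [apply Hsin; lra|].
    cut (dens k1 k2 beta d1 d2 x < dens k1 k2 beta d1' d2' x); [lra|].
    apply inv_sqrt_lt; split; [apply Rmin_pos_dens; lra|].
    assert (d1' * x < d1 * x) by (apply Rmult_lt_compat_r; lra).
    assert (d2' * (beta - x) <= d2 * (beta - x)) by (apply Rmult_le_compat_r; lra).
    assert (d1' * x < d1' * b) by (apply Rmult_lt_compat_l; lra).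
    assert (d2' * x < d2' * b) by (apply Rmult_lt_compat_l; lra).
    rewrite Rmin_left by lra; apply Rmin_glb_lt; lra.
  - apply (gint_pos_sub _ 0 beta b beta _ ltac:(lra) ltac:(lra) ltac:(lra) Hle) in G; auto.
    intros x Hx; apply Rmult_lt_0_compat; [apply Hsin; lra|].
    cut (dens k1 k2 beta d1 d2 x < dens k1 k2 beta d1' d2' x); [lra|].
    apply inv_sqrt_lt; split; [apply Rmin_pos_dens; lra|].
    assert (d1' * x <= d1 * x) by (apply Rmult_le_compat_r; lra).
    assert (d2' * (beta - x) < d2 * (beta - x)) by (apply Rmult_lt_compat_r; lra).
    assert (d1' * b < d1' * x) by (apply Rmult_lt_compat_l; lra).
    assert (d2' * b < d2' * x) by (apply Rmult_lt_compat_l; lra).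
    rewrite Rmin_right by lra; apply Rmin_glb_lt; lra.
Qed.

(* The densities cross exactly once, where the second side of the first tent meets the
   first side of the second tent; the sine vanishing there separates them. *)
Lemma compare_crossed : d1' < d1 -> d2 < d2' -> False.
Proof.
  intros H1 H2.
  assert (B := tent_apex_interior _ _ _ _ _ _ _ HT).
  destruct (tent_apex _ _ _ _ _ _ _ HT) as [A1 A2].
  assert (B' := tent_apex_interior _ _ _ _ _ _ _ HT').
  destruct (tent_apex _ _ _ _ _ _ _ HT') as [A1' A2'].
  set (b := T sM) in *; set (b' := T' sM') in *.
  destruct HT as (K1 & K2 & D1 & D2 & _); destruct HT' as (_ & _ & D1' & D2' & _).
  set (z := (k2 ^ 2 - k1 ^ 2 + 2 * d2 * beta) / (2 * (d1' + d2))).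
  assert (Hz : forall x, k2 ^ 2 + 2 * d2 * (beta - x) - (k1 ^ 2 + 2 * d1' * x) = 2 * (d1' + d2) * (z - x)).
  { intros x; unfold z; field; lra. }
  assert (D : 0 < d1' + d2) by lra.
  assert (Hz0 : 0 < z).
  { assert (E := Hz 0). assert (0 < d1 * b) by (apply Rmult_lt_0_compat; lra).
    assert (0 < d2 * b) by (apply Rmult_lt_0_compat; lra). nra. }
  assert (Hzb : z < beta).
  { assert (E := Hz beta). assert (0 < d2' * (beta - b')) by (apply Rmult_lt_0_compat; lra).
    assert (0 < d1' * (beta - b')) by (apply Rmult_lt_0_compat; lra). nra. }
  assert (Hcmp : forall x, 0 < x < beta ->
    d1' * x < d1 * x /\ d2 * (beta - x) < d2' * (beta - x)).
  { intros x Hx; split; apply Rmult_lt_compat_r; lra. }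
  assert (Left : forall x, 0 < x < z -> dens k1 k2 beta d1 d2 x < dens k1 k2 beta d1' d2' x).
  { intros x Hx; apply inv_sqrt_lt; split; [apply Rmin_pos_dens; lra|].
    assert (E := Hz x); destruct (Hcmp x ltac:(lra)) as [C1 C2].
    assert (0 < (d1' + d2) * (z - x)) by (apply Rmult_lt_0_compat; lra).
    eapply Rle_lt_trans; [apply Rmin_l|]; apply Rmin_glb_lt; lra. }
  assert (Right : forall x, z < x < beta -> dens k1 k2 beta d1' d2' x < dens k1 k2 beta d1 d2 x).
  { intros x Hx; apply inv_sqrt_lt; split; [apply Rmin_pos_dens; lra|].
    assert (E := Hz x); destruct (Hcmp x ltac:(lra)) as [C1 C2].
    assert (0 < (d1' + d2) * (x - z)) by (apply Rmult_lt_0_compat; lra).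
    eapply Rle_lt_trans; [apply Rmin_r|]; apply Rmin_glb_lt; lra. }
  assert (G := dens_diff_gint (PI - z)).
  assert (Hsin : forall x, sin (x + (PI - z)) = sin (z - x)).
  { intros x; replace (x + (PI - z)) with (PI - (z - x)) by ring; apply sin_PI_x. }
  cut (0 < 0); [lra|].
  apply (gint_pos_sub _ 0 beta 0 z _ ltac:(lra) ltac:(lra) ltac:(lra)) in G; auto.
  - intros x Hx; rewrite Hsin; destruct (Rtotal_order x z) as [H|[H|H]].
    + apply Rmult_le_pos; [apply sin_ge_0; lra|]. specialize (Left x); lra.
    + rewrite H, Rminus_diag, sin_0; lra.
    + replace (z - x) with (- (x - z)) by ring; rewrite sin_neg.
      assert (0 < sin (x - z)) by (apply sin_gt_0; lra); specialize (Right x); nra.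
  - intros x Hx; rewrite Hsin; apply Rmult_lt_0_compat; [apply sin_gt_0; lra|]; specialize (Left x); lra.
Qed.
End Compare.

(** Every way in which the rates can differ is ordered or crossed, possibly after exchanging the
    tents. Equal rates give equal sides, whose intersection fixes the apex angle, then the apex
    curvature, then the lengths. *)
Lemma tent_unique (k1 k2 beta d1 d2 sM sF d1' d2' sM' sF' : R) :
  tent k1 k2 beta d1 d2 sM sF -> tent k1 k2 beta d1' d2' sM' sF' -> beta < PI ->
  (forall v, RInt (fun t => sin (turn (clothoid_pair_curv k1 k2 d1 d2 sM sF) t + v)) 0 sF =
             RInt (fun t => sin (turn (clothoid_pair_curv k1 k2 d1' d2' sM' sF') t + v)) 0 sF') ->
  (d1, d2, sM, sF) = (d1', d2', sM', sF').
Proof.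
  intros H H' Hb E.
  assert (E' := fun v => eq_sym (E v)).
  assert (C1 := compare_ordered _ _ _ _ _ _ _ _ _ _ _ H H' Hb E).
  assert (C2 := compare_crossed _ _ _ _ _ _ _ _ _ _ _ H H' Hb E).
  assert (C1' := compare_ordered _ _ _ _ _ _ _ _ _ _ _ H' H Hb E').
  assert (C2' := compare_crossed _ _ _ _ _ _ _ _ _ _ _ H' H Hb E').
  assert (D1 : d1' = d1) by (destruct (Rtotal_order d1 d1') as [?|[?|?]], (Rtotal_order d2 d2') as [?|[?|?]];
    try lra; exfalso; (apply C1 || apply C2 || apply C1' || apply C2'); lra).
  assert (D2 : d2' = d2) by (destruct (Rtotal_order d2 d2') as [?|[?|?]];
    try lra; exfalso; (apply C1 || apply C1'); lra).
  subst d1' d2'; clear C1 C2 C1' C2' E E'.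
  destruct (tent_apex _ _ _ _ _ _ _ H) as [A1 A2].
  destruct (tent_apex _ _ _ _ _ _ _ H') as [A1' A2'].
  destruct H as (K1 & K2 & D1 & D2 & HM & Hj & _), H' as (_ & _ & _ & _ & HM' & Hj' & _).
  set (b := turn _ sM) in *; set (b' := turn _ sM') in *.
  assert (Eb : b = b') by (assert ((d1 + d2) * (b - b') = 0) by lra; nra).
  rewrite <- Eb in *.
  assert (Ek : k1 + d1 * sM = k1 + d1 * sM').
  { apply Rsqr_inj; unfold Rsqr; try nra. }
  assert (EM : sM = sM') by nra.
  assert (EF : sF = sF') by (subst sM'; nra).
  now subst.
Qed.

(** * The integral along one arc *)

(** [∫ f(angle) ds] along the arc whose curvature grows linearly from [k0] to [k] while the
    tangent turns by [x], rescaled to the unit interval so that [x = 0] needs no special case. *)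
Definition arc_int (f : R -> R) (k0 x k : R) : R :=
  2 * x / (k0 + k) *
  RInt (fun t => f (2 * x / (k0 + k) * (k0 * t + (k - k0) * t ^ 2 / 2))) 0 1.

Lemma continuous_quad_comp (f : R -> R) (k d x : R) :
  (forall y, continuous f y) -> continuous (fun t => f (k * t + d * t ^ 2 / 2)) x.
Proof.
  intros Hf; apply (continuous_comp (fun t => k * t + d * t ^ 2 / 2) f); [|apply Hf].
  apply (is_derive_continuous _ x (k + d * x)); auto_derive; auto; field.
Qed.

(** The factor [2 * x / (k0 + k)] in [arc_int] is the length of the arc: its angle divided by its
    mean curvature. *)
Lemma arc_int_unscaled (f : R -> R) (k0 d L : R) :
  (forall x, continuous f x) -> 0 < 2 * k0 + d * L ->
  arc_int f k0 (k0 * L + d * L ^ 2 / 2) (k0 + d * L) =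
  RInt (fun t => f (k0 * t + d * t ^ 2 / 2)) 0 L.
Proof.
  intros Hf HL; unfold arc_int.
  replace (2 * _ / _) with L by (field; lra).
  assert (E := RInt_affine _ L 0 0 1 (fun x => continuous_quad_comp f k0 d x Hf)).
  replace (L * 0 + 0) with 0 in E by ring; replace (L * 1 + 0) with L in E by ring; etransitivity; [|exact E].
  f_equal; apply RInt_ext; intros x _; f_equal; as_R; field.
Qed.

(** Over the angle [x] the squared curvature goes affinely from [k0 ^ 2] to [k ^ 2]. With the
    angular interval fixed, the dependence on [k] can be compared pointwise. *)
Lemma arc_int_gint (f : R -> R) (k0 x k : R) :
  (forall x, continuous f x) -> 0 < x -> 0 <= k0 < k ->
  gint (fun y => f y * / sqrt (k0 ^ 2 + (k ^ 2 - k0 ^ 2) * (y / x))) 0 x (arc_int f k0 x k).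
Proof.
  intros Hf Hx Hk; set (L := 2 * x / (k0 + k)); set (d := (k - k0) / L).
  assert (HL : 0 < L) by (apply Rdiv_lt_0_compat; lra).
  assert (Hd : 0 < d) by (apply Rdiv_lt_0_compat; lra).
  assert (Ek : k0 + d * L = k) by (unfold d; field; lra).
  assert (Ex : k0 * L + d * L ^ 2 / 2 = x).
  { replace (_ + _) with (L * (k0 + (k0 + d * L)) / 2) by field; rewrite Ek; unfold L; field; lra. }
  assert (G := gint_arc f k0 d L Hf ltac:(lra) Hd ltac:(lra)).
  rewrite <- arc_int_unscaled, Ex, Ek in G by (auto; lra).
  eapply gint_ext, G; intros y _; cbv beta; do 3 f_equal.
  unfold d, L; field; lra.
Qed.

Lemma arc_profile_pos (k0 x k y : R) :
  0 < x -> 0 <= k0 < k -> 0 < y < x ->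
  0 < k0 ^ 2 + (k ^ 2 - k0 ^ 2) * (y / x) < k ^ 2.
Proof.
  intros Hx Hk Hy.
  assert (0 < y / x) by (apply Rdiv_lt_0_compat; lra).
  assert (y / x < 1) by (apply Rlt_div_l; lra).
  assert (0 < k ^ 2 - k0 ^ 2) by nra.
  assert (0 <= k0 ^ 2) by apply pow2_ge_0.
  nra.
Qed.

Lemma arc_int_decreasing (f : R -> R) (k0 x k k' : R) :
  (forall y, continuous f y) -> (forall y, 0 < y < x -> 0 < f y) ->
  0 < x -> 0 <= k0 < k -> k < k' -> arc_int f k0 x k' < arc_int f k0 x k.
Proof.
  intros Hf Hpos Hx Hk Hk'.
  cut (0 < arc_int f k0 x k - arc_int f k0 x k'); [lra|].
  eapply gint_pos; [exact Hx| |apply gint_minus; apply arc_int_gint; auto; lra].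
  intros y Hy; cbv beta; rewrite <- Rmult_minus_distr_l; apply Rmult_lt_0_compat; auto.
  cut (/ sqrt (k0 ^ 2 + (k' ^ 2 - k0 ^ 2) * (y / x)) < / sqrt (k0 ^ 2 + (k ^ 2 - k0 ^ 2) * (y / x))); [lra|].
  apply inv_sqrt_lt; split; [apply arc_profile_pos; auto|].
  assert (0 < y / x) by (apply Rdiv_lt_0_compat; lra).
  apply Rplus_lt_compat_l, Rmult_lt_compat_r; auto; nra.
Qed.

Lemma arc_int_gt_circle (f : R -> R) (k0 x k : R) :
  (forall y, continuous f y) -> (forall y, 0 < y < x -> 0 < f y) ->
  0 < x -> 0 <= k0 < k -> / k * RInt f 0 x < arc_int f k0 x k.
Proof.
  intros Hf Hpos Hx Hk.
  cut (0 < arc_int f k0 x k - / k * RInt f 0 x); [lra|].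
  eapply gint_pos; [exact Hx| |apply gint_minus; [apply arc_int_gint; auto; lra|apply gint_RInt; auto]].
  intros y Hy; cbv beta; rewrite <- Rmult_minus_distr_l; apply Rmult_lt_0_compat; auto.
  cut (/ k < / sqrt (k0 ^ 2 + (k ^ 2 - k0 ^ 2) * (y / x))); [lra|].
  rewrite <- (sqrt_pow2 k) at 1 by lra.
  apply inv_sqrt_lt, arc_profile_pos; auto.
Qed.

Lemma arc_int_0 (f : R -> R) (k0 k : R) : arc_int f k0 0 k = 0.
Proof. unfold arc_int; replace (2 * 0 / (k0 + k)) with 0 by (unfold Rdiv; ring); ring. Qed.

(** The sinusoid is odd about [beta / 2] and has integral zero, so the midpoint value of the density
    can be subtracted for free. The density decreases, so the difference then has the sign of the
    sinusoid. *)
Lemma arc_int_sin_pos (beta k0 k : R) :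
  0 < beta < PI -> 0 <= k0 < k -> 0 < arc_int (fun y => sin (-1 * y + beta / 2)) k0 beta k.
Proof.
  intros Hb Hk.
  set (f := fun y => sin (-1 * y + beta / 2)).
  set (p := fun y => k0 ^ 2 + (k ^ 2 - k0 ^ 2) * (y / beta)).
  assert (Hf : forall y, continuous f y) by (intros; apply continuous_sin_affine).
  assert (E : RInt f 0 beta = 0).
  { unfold f; rewrite RInt_sin_affine by lra.
    replace (-1 * beta + beta / 2) with (- (beta / 2)) by field; rewrite cos_neg.
    replace (-1 * 0 + beta / 2) with (beta / 2) by field; as_R; field. }
  replace (arc_int f k0 beta k) with (arc_int f k0 beta k - / sqrt (p (beta / 2)) * RInt f 0 beta)
    by (rewrite E; ring).
  assert (Hp : forall y z, 0 < y < beta -> 0 < z < beta -> y < z -> / sqrt (p z) < / sqrt (p y)).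
  { intros y z Hy Hz Hyz; apply inv_sqrt_lt; split; [apply arc_profile_pos; lra|].
    apply Rplus_lt_compat_l, Rmult_lt_compat_l; [nra|].
    apply Rmult_lt_compat_r; auto; apply Rinv_0_lt_compat; lra. }
  assert (Pos : forall y, 0 < y < beta / 2 -> 0 < f y * / sqrt (p y) - f y * / sqrt (p (beta / 2))).
  { intros y Hy; rewrite <- Rmult_minus_distr_l; apply Rmult_lt_0_compat.
    - apply sin_gt_0; lra.
    - specialize (Hp y (beta / 2)); lra. }
  eapply (gint_pos_sub _ 0 beta 0 (beta / 2)); [lra|lra|lra| | |
    apply gint_minus; [apply arc_int_gint; auto; lra|apply gint_RInt; auto]]; [|exact Pos].
  intros y Hy; destruct (Rtotal_order y (beta / 2)) as [H|[H|H]].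
  - left; apply Pos; lra.
  - rewrite H; fold (p (beta / 2)); lra.
  - fold (p y); rewrite <- Rmult_minus_distr_l.
    assert (0 < - f y) by (unfold f; rewrite <- sin_neg; apply sin_gt_0; lra).
    specialize (Hp (beta / 2) y); nra.
Qed.

Lemma arc_int_le (f : R -> R) (k0 x k : R) :
  (forall y, continuous f y) -> (forall y, f y <= 1) -> 0 <= x -> 0 < k0 + k ->
  arc_int f k0 x k <= 2 * x / (k0 + k).
Proof.
  intros Hf H1 Hx Hk; unfold arc_int; set (L := 2 * x / (k0 + k)).
  assert (HL : 0 <= L) by (apply Rmult_le_pos; [lra|left; apply Rinv_0_lt_compat; lra]).
  apply Rle_trans with (L * RInt (fun _ : R => 1) 0 1); [apply Rmult_le_compat_l; auto|].
  - apply RInt_le; [lra| | |].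
    + apply continuous_ex_RInt; intros y.
      apply (continuous_comp (fun t => L * (k0 * t + (k - k0) * t ^ 2 / 2)) f); [|apply Hf].
      apply (is_derive_continuous _ y (L * (k0 + (k - k0) * y))); auto_derive; auto; field.
    + apply continuous_ex_RInt; intros; apply continuous_const.
    + auto.
  - rewrite RInt_const; unfold scal; simpl; unfold mult; simpl; lra.
Qed.

Lemma continuous_squeeze (g h : R -> R) (p : R) :
  continuous h p -> h p = 0 -> (forall y, Rabs (g y - g p) <= h y) -> continuous g p.
Proof.
  intros Hh H0 H; apply continuity_pt_filterlim, continuity_pt_locally; intros eps.
  apply continuity_pt_filterlim, continuity_pt_locally with (eps := eps) in Hh.
  revert Hh; apply filter_imp; intros y Hy.
  eapply Rle_lt_trans; [apply H|]; rewrite H0, Rminus_0_r in Hy.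
  eapply Rle_lt_trans; [apply Rle_abs|exact Hy].
Qed.

(** For a 1-Lipschitz [f] the integrand moves no more than its argument, which is bounded uniformly
    in [t] on the unit interval by the changes of the length [L] and of [k]. *)
Lemma continuous_arc_int (f x k : R -> R) (k0 p : R) :
  (forall y z, Rabs (f y - f z) <= Rabs (y - z)) ->
  continuous x p -> continuous k p -> k0 + k p <> 0 ->
  continuous (fun y => arc_int f k0 (x y) (k y)) p.
Proof.
  intros Hf Hx Hk Hp.
  assert (Cf : forall y, continuous f y).
  { intros y; apply (continuous_squeeze f (fun z => Rabs (z - y))); auto.
    - apply (continuous_comp (fun z => z - y) Rabs); [|apply continuous_Rabs].
      apply (is_derive_continuous _ y 1); auto_derive; auto.
    - rewrite Rminus_diag; apply Rabs_R0. }
  set (L := fun y => 2 * x y / (k0 + k y)).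
  assert (CL : continuous L p).
  { apply continuity_pt_filterlim, continuity_pt_div.
    - apply continuity_pt_mult; [apply continuity_pt_const; intros ? ?; auto|apply continuity_pt_filterlim, Hx].
    - apply continuity_pt_plus; [apply continuity_pt_const; intros ? ?; auto|apply continuity_pt_filterlim, Hk].
    - exact Hp. }
  set (a := fun y t => L y * (k0 * t + (k y - k0) * t ^ 2 / 2)).
  assert (Ca : forall y t, continuous (fun t => f (a y t)) t).
  { intros y t; apply (continuous_comp (a y) f); [|apply Cf].
    apply (is_derive_continuous _ t (L y * (k0 + (k y - k0) * t))); unfold a; auto_derive; auto; field. }
  apply (continuous_mult L (fun y => RInt (fun t => f (a y t)) 0 1)); auto.
  apply (continuous_squeeze _ (fun y =>
    Rabs (L y - L p) * (Rabs k0 + Rabs (k y - k0)) + Rabs (L p) * Rabs (k y - k p))).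
  - assert (CA : forall g c, continuous g p -> continuous (fun y => Rabs (g y - c)) p).
    { intros g c Hg; apply (continuous_comp (fun y => g y - c) Rabs); [|apply continuous_Rabs].
      apply (continuous_minus g (fun _ => c)); [auto|apply continuous_const]. }
    apply (continuous_plus (fun y => Rabs (L y - L p) * (Rabs k0 + Rabs (k y - k0)))).
    + apply (continuous_mult (fun y => Rabs (L y - L p))); auto.
      apply (continuous_plus (fun _ => Rabs k0)); [apply continuous_const|auto].
    + apply (continuous_mult (fun _ => Rabs (L p))); [apply continuous_const|auto].
  - rewrite !Rminus_diag, Rabs_R0; ring.
  - intros y.
    replace (RInt (fun t => f (a y t)) 0 1 - RInt (fun t => f (a p t)) 0 1)
      with (RInt (fun t => 1 * f (a y t) + (-1) * f (a p t)) 0 1)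
      by (rewrite RInt_lin by auto; as_R; ring).
    match goal with |- _ <= ?B => replace B with ((1 - 0) * B) by ring end.
    apply abs_RInt_le_const; [lra| |].
    + apply continuous_ex_RInt; intros t.
      apply (continuous_plus (fun t => 1 * f (a y t)));
        [apply (continuous_mult (fun _ => 1) (fun t => f (a y t)))
        |apply (continuous_mult (fun _ => -1) (fun t => f (a p t)))]; auto; apply continuous_const.
    + intros t Ht.
      replace (1 * f (a y t) + -1 * f (a p t)) with (f (a y t) - f (a p t)) by ring.
      eapply Rle_trans; [apply Hf|].
      replace (a y t - a p t) with
        ((L y - L p) * (k0 * t + (k y - k0) * (t ^ 2 / 2)) + L p * ((k y - k p) * (t ^ 2 / 2)))
        by (unfold a; field).
      assert (T2 : 0 <= t ^ 2 / 2 <= 1) by nra.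
      assert (AM : forall u c, 0 <= c <= 1 -> Rabs (u * c) <= Rabs u).
      { intros u c Hc; rewrite Rabs_mult, (Rabs_pos_eq c) by lra.
        assert (0 <= Rabs u) by apply Rabs_pos; nra. }
      eapply Rle_trans; [apply Rabs_triang|]; rewrite !(Rabs_mult (L _ - L _)), !(Rabs_mult (L p)).
      apply Rplus_le_compat; apply Rmult_le_compat_l; try apply Rabs_pos; [|apply AM, T2].
      eapply Rle_trans; [apply Rabs_triang|]; apply Rplus_le_compat; apply AM; auto.
Qed.

(** * Existence *)

Lemma lipschitz_of_derive (f df : R -> R) :
  (forall x, is_derive f x (df x)) -> (forall x, Rabs (df x) <= 1) ->
  forall x y, Rabs (f x - f y) <= Rabs (x - y).
Proof.
  intros Hd H1 x y; rewrite <- (Rmult_1_l (Rabs (x - y))).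
  apply (bounded_variation f df); intros t _; split; auto.
Qed.

Lemma sin_reflected_lipschitz (b x y : R) :
  Rabs (sin (-1 * x + b) - sin (-1 * y + b)) <= Rabs (x - y).
Proof.
  apply (lipschitz_of_derive (fun x => sin (-1 * x + b)) (fun x => - cos (-1 * x + b))); intros z.
  - auto_derive; auto; ring.
  - rewrite Rabs_Ropp; apply Rabs_le, COS_bound.
Qed.

Lemma cos_reflected_lipschitz (b x y : R) :
  Rabs (cos (-1 * x + b) - cos (-1 * y + b)) <= Rabs (x - y).
Proof.
  apply (lipschitz_of_derive (fun x => cos (-1 * x + b)) (fun x => sin (-1 * x + b))); intros z.
  - auto_derive; auto; ring.
  - apply Rabs_le, SIN_bound.
Qed.

Section Shooting.
Variables k1 k2 kC beta : R.
Hypothesis Hk1 : 0 <= k1 < kC.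
Hypothesis Hk2 : 0 <= k2 < kC.
Hypothesis Hbeta : 0 < beta < PI.

(** Components along ([c]) and across ([s]) the chord of the circle arc, which makes the angle
    [beta / 2] with both end tangents. Replacing [y] by [beta - y] preserves [c] and negates [s], so
    the same functions serve the second arc read backwards. [G b k] is the extent along the chord of
    the pair with apex angle [b] and apex curvature [k]. *)
Let c := fun y => cos (-1 * y + beta / 2).
Let s := fun y => sin (-1 * y + beta / 2).
Let G b k := arc_int c k1 b k + arc_int c k2 (beta - b) k.
Let chord := 2 * sin (beta / 2) / kC.

Let Cc : forall y, continuous c y.
Proof. intros; apply continuous_cos_affine. Qed.

Let c_pos (x y : R) : x <= beta -> 0 < y < x -> 0 < c y.
Proof. intros Hx Hy; apply cos_gt_0; lra. Qed.

Lemma G_decreasing (b k k' : R) : 0 <= b <= beta -> kC <= k -> k < k' -> G b k' < G b k.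
Proof.
  intros Hb Hk Hk'; unfold G.
  destruct (Req_dec b 0) as [->|H0].
  - rewrite !arc_int_0; apply Rplus_lt_compat_l, arc_int_decreasing; auto; try lra.
    intros y; apply c_pos; lra.
  - apply Rplus_lt_le_compat; [apply arc_int_decreasing; auto; try lra; intros y; apply c_pos; lra|].
    destruct (Req_dec b beta) as [->|H1].
    + rewrite Rminus_diag, !arc_int_0; lra.
    + left; apply arc_int_decreasing; auto; try lra; intros y; apply c_pos; lra.
Qed.

(** With apex curvature [kC] both arcs are less curved than the circle, hence longer at every angle.
    This is also what puts the root strictly above [kC]. *)
Lemma G_at_kC (b : R) : 0 <= b <= beta -> chord < G b kC.
Proof.
  intros Hb; unfold G.
  assert (E : forall x, RInt c 0 x = sin (beta / 2) - sin (beta / 2 - x)).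
  { intros x; unfold c; rewrite RInt_cos_affine by lra; as_R.
    replace (-1 * x + beta / 2) with (beta / 2 - x) by ring.
    replace (-1 * 0 + beta / 2) with (beta / 2) by ring; field. }
  assert (A : forall k0 x, 0 <= k0 < kC -> 0 < x <= beta ->
    / kC * (sin (beta / 2) - sin (beta / 2 - x)) < arc_int c k0 x kC).
  { intros k0 x Hk Hx; rewrite <- E; apply arc_int_gt_circle; auto; try lra.
    intros y; apply c_pos; lra. }
  assert (Hs : / kC * (sin (beta / 2) - sin (beta / 2 - b))
    + / kC * (sin (beta / 2) - sin (beta / 2 - (beta - b))) = chord).
  { replace (beta / 2 - (beta - b)) with (- (beta / 2 - b)) by field; rewrite sin_neg.
    unfold chord; field; lra. }
  destruct (Req_dec b 0) as [->|H0].
  - rewrite arc_int_0; assert (H := A k2 (beta - 0) Hk2 ltac:(lra)).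
    rewrite Rminus_0_r, Rminus_diag in Hs; lra.
  - assert (H := A k1 b Hk1 ltac:(lra)); destruct (Req_dec b beta) as [->|H1].
    + rewrite Rminus_diag, arc_int_0 in *; rewrite Rminus_0_r, Rminus_diag in Hs; lra.
    + assert (H' := A k2 (beta - b) Hk2 ltac:(lra)); lra.
Qed.

Let sin_half_pos : 0 < sin (beta / 2).
Proof. apply sin_gt_0; lra. Qed.

Lemma G_large (b : R) : 0 <= b <= beta -> exists K, kC < K /\ G b K < chord.
Proof.
  (* Bounding the cosine by 1 gives [G b K <= 2 * beta / K], and [K] is such that [chord * K = 2 *
     sin (beta / 2) + 2 * beta]. *)
  intros Hb; set (K := kC + beta * kC / sin (beta / 2)).
  assert (HK : 0 < beta * kC / sin (beta / 2)).
  { apply Rdiv_lt_0_compat; auto; apply Rmult_lt_0_compat; lra. }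
  exists K; split; [unfold K; lra|].
  assert (A : forall k0 x, 0 <= k0 -> 0 <= x -> arc_int c k0 x K <= 2 * x / K).
  { intros k0 x Hk Hx; eapply Rle_trans; [apply arc_int_le; auto|].
    - intros y; apply COS_bound.
    - unfold K; lra.
    - apply Rmult_le_compat_l; [lra|]; apply Rinv_le_contravar; unfold K; lra. }
  apply Rle_lt_trans with (2 * beta / K).
  - replace (2 * beta / K) with (2 * b / K + 2 * (beta - b) / K) by (field; unfold K; lra).
    apply Rplus_le_compat; apply A; lra.
  - apply Rlt_div_l; [unfold K; lra|].
    replace (chord * K) with (2 * sin (beta / 2) + 2 * beta) by (unfold chord, K; field; lra).
    lra.
Qed.

(** The intermediate value theorem is applied to functions continuous on the whole line; [Rmax k kC]
    keeps [k1 + k] and [k2 + k] away from zero. *)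
Lemma G_continuous_k (b k : R) : continuous (fun k => G b (Rmax k kC)) k.
Proof.
  apply (continuous_plus (fun k => arc_int c k1 b (Rmax k kC)));
    [apply (continuous_arc_int c (fun _ => b) (fun k => Rmax k kC))
    |apply (continuous_arc_int c (fun _ => beta - b) (fun k => Rmax k kC))];
    try apply continuous_const; try apply continuous_Rmax_l; try apply cos_reflected_lipschitz;
    assert (H := Rmax_r k kC); lra.
Qed.

Lemma G_root (b : R) : 0 <= b <= beta -> exists k, kC < k /\ G b k = chord.
Proof.
  intros Hb; destruct (G_large b Hb) as (K & HK & HG).
  assert (H0 := G_at_kC b Hb).
  destruct (IVT_gen (fun k => G b (Rmax k kC)) kC K chord) as (k & Hk & E).
  - intros k; apply continuity_pt_filterlim, G_continuous_k.
  - rewrite (Rmax_left kC), (Rmax_left K) by lra; rewrite Rmin_right, Rmax_left by lra; lra.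
  - rewrite Rmin_left, Rmax_right in Hk by lra; rewrite Rmax_left in E by lra.
    exists k; split; auto; destruct (Req_dec k kC) as [->|]; lra.
Qed.

(** Projection onto [[0, beta]], which extends the shooting function continuously to the whole
    line. *)
Let clamp b := Rmax (Rmin b beta) 0.

Let clamp_range (b : R) : 0 <= clamp b <= beta.
Proof. unfold clamp, Rmax, Rmin; destruct Rle_dec; destruct Rle_dec; lra. Qed.

Let clamp_id (b : R) : 0 <= b <= beta -> clamp b = b.
Proof. intros H; unfold clamp; rewrite Rmin_left, Rmax_left; lra. Qed.

Let clamp_continuous (b : R) : continuous clamp b.
Proof.
  apply (continuous_comp (fun b => Rmin b beta) (fun y => Rmax y 0));
    [apply continuous_Rmin_l|apply continuous_Rmax_l].
Qed.

Lemma arc_int_clamp_continuous (f k : R -> R) (b : R) :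
  (forall y z, Rabs (f y - f z) <= Rabs (y - z)) -> continuous k b -> kC <= k b ->
  continuous (fun b => arc_int f k1 (clamp b) (k b)) b /\
  continuous (fun b => arc_int f k2 (beta - clamp b) (k b)) b.
Proof.
  intros Hf Hk HkC; split; apply continuous_arc_int; auto; try lra.
  apply (continuous_minus (fun _ => beta)); [apply continuous_const|apply clamp_continuous].
Qed.

Lemma apex_exists : exists b k, 0 < b < beta /\ kC < k /\ G b k = chord /\
  arc_int s k1 b k = arc_int s k2 (beta - b) k.
Proof.
  destruct (constructive_indefinite_description (fun kM => forall b, kC < kM b /\ G (clamp b) (kM b) = chord))
    as [kM HkM].
  { exists (fun b => proj1_sig (constructive_indefinite_description _ (G_root (clamp b) (clamp_range b)))).
    intros b; apply (proj2_sig (constructive_indefinite_description _ (G_root (clamp b) (clamp_range b)))). }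
  (* Strict monotonicity in [k] replaces the implicit function theorem: near [p], [G] stays above
     [chord] at [kM p - e] and below it at [kM p + e], which traps [kM b] between the two. The bound
     [e <= kM p - kC] keeps the lower value in the range of monotonicity. *)
  assert (Cont : forall p, continuous kM p).
  { intros p; apply continuity_pt_filterlim, continuity_pt_locally; intros eps.
    destruct (HkM p) as [Hp Ep].
    set (e := Rmin eps (kM p - kC)).
    assert (He : 0 < e) by (apply Rmin_glb_lt; [apply cond_pos|lra]).
    assert (He1 : e <= eps) by apply Rmin_l; assert (He2 : e <= kM p - kC) by apply Rmin_r.
    assert (GC : forall k, kC <= k -> continuous (fun b => G (clamp b) k) p).
    { intros k Hk; destruct (arc_int_clamp_continuous c (fun _ => k) p) as [A1 A2]; auto.
      - apply cos_reflected_lipschitz.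
      - apply continuous_const.
      - apply (continuous_plus (fun b => arc_int c k1 (clamp b) k)); auto. }
    assert (Hlow := G_decreasing (clamp p) (kM p - e) (kM p) (clamp_range p) ltac:(lra) ltac:(lra)).
    assert (Hup := G_decreasing (clamp p) (kM p) (kM p + e) (clamp_range p) ltac:(lra) ltac:(lra)).
    rewrite Ep in Hlow, Hup.
    assert (L1 := GC (kM p - e) ltac:(lra)); assert (L2 := GC (kM p + e) ltac:(lra)).
    apply continuity_pt_filterlim in L1, L2; rewrite continuity_pt_locally in L1, L2.
    assert (P1 : 0 < G (clamp p) (kM p - e) - chord) by lra.
    assert (P2 : 0 < chord - G (clamp p) (kM p + e)) by lra.
    generalize (filter_and _ _ (L1 (mkposreal _ P1)) (L2 (mkposreal _ P2))); apply filter_imp.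
    simpl; intros b [B1 B2]; apply Rabs_def2 in B1; apply Rabs_def2 in B2.
    destruct (HkM b) as [Hb Eb]; apply Rabs_def1.
    - apply Rlt_le_trans with e; auto; apply Rnot_le_lt; intros H.
      destruct (Req_dec (kM b) (kM p + e)) as [E|E]; [rewrite <- E in B2; lra|].
      assert (D := G_decreasing (clamp b) (kM p + e) (kM b) (clamp_range b) ltac:(lra) ltac:(lra)); lra.
    - apply Rle_lt_trans with (- e); [lra|]; apply Rnot_le_lt; intros H.
      destruct (Req_dec (kM b) (kM p - e)) as [E|E]; [rewrite <- E in B1; lra|].
      assert (D := G_decreasing (clamp b) (kM b) (kM p - e) (clamp_range b) ltac:(lra) ltac:(lra)); lra. }
  set (H b := arc_int s k1 (clamp b) (kM b) - arc_int s k2 (beta - clamp b) (kM b)).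
  assert (HC : continuity H).
  { intros b; apply continuity_pt_filterlim; destruct (HkM b) as [Hb _].
    destruct (arc_int_clamp_continuous s kM b) as [A1 A2]; auto; [apply sin_reflected_lipschitz|lra|].
    apply (continuous_minus (fun b => arc_int s k1 (clamp b) (kM b))); auto. }
  (* At [b = 0] only the second arc is left and at [b = beta] only the first; either one alone
     contributes a positive amount, but they enter [H] with opposite signs. *)
  assert (H0 : H 0 < 0).
  { unfold H; rewrite clamp_id, arc_int_0, Rminus_0_r by lra.
    assert (P := arc_int_sin_pos beta k2 (kM 0) Hbeta); destruct (HkM 0); fold s in P; lra. }
  assert (H1 : 0 < H beta).
  { unfold H; rewrite clamp_id, Rminus_diag, arc_int_0 by lra.
    assert (P := arc_int_sin_pos beta k1 (kM beta) Hbeta); destruct (HkM beta); fold s in P; lra. }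
  destruct (IVT_gen H 0 beta 0 HC) as (b & Hb & E).
  { rewrite Rmin_left, Rmax_right; lra. }
  rewrite Rmin_left, Rmax_right in Hb by lra.
  assert (b <> 0) by (intros ->; lra); assert (b <> beta) by (intros ->; lra).
  destruct (HkM b) as [Hk EG]; unfold H in E; rewrite clamp_id in E, EG by lra.
  exists b, (kM b); repeat split; auto; lra.
Qed.
End Shooting.

(** * From the apex to the four parameters *)

Lemma arc_int_ext (f g : R -> R) (k0 x k : R) :
  (forall y, f y = g y) -> arc_int f k0 x k = arc_int g k0 x k.
Proof. intros E; unfold arc_int; f_equal; apply RInt_ext; auto. Qed.

Lemma arc_int_opp (f : R -> R) (k0 x k : R) :
  (forall y, continuous f y) ->
  arc_int (fun y => - f y) k0 x k = - arc_int f k0 x k.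
Proof.
  intros Hf; unfold arc_int.
  rewrite (RInt_ext _ (fun t => opp (f (2 * x / (k0 + k) * (k0 * t + (k - k0) * t ^ 2 / 2))))) by auto.
  rewrite (RInt_opp (fun t => f (2 * x / (k0 + k) * (k0 * t + (k - k0) * t ^ 2 / 2)))).
  - change opp with Ropp; as_R; ring.
  - apply continuous_ex_RInt; intros y.
    apply (continuous_comp (fun t => 2 * x / (k0 + k) * (k0 * t + (k - k0) * t ^ 2 / 2)) f); [|apply Hf].
    apply (is_derive_continuous _ y (2 * x / (k0 + k) * (k0 + (k - k0) * y))).
    set (L := 2 * x / (k0 + k)); auto_derive; auto; field.
Qed.

(** The problem stripped of the corner. A sine of arbitrary phase [v] encodes both coordinates of
    the end point, and [beta / kC] is the length of the circle arc. *)
Definition solves (k1 k2 kC beta : R) (prm : R * R * R * R) : Prop :=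
  let '(d1, d2, sM, sF) := prm in
  tent k1 k2 beta d1 d2 sM sF /\ kC < k1 + d1 * sM /\
  forall v, RInt (fun t => sin (turn (clothoid_pair_curv k1 k2 d1 d2 sM sF) t + v)) 0 sF =
            RInt (fun t => sin (kC * t + v)) 0 (beta / kC).

Lemma RInt_reflect (f : R -> R) (S a : R) :
  (forall x, continuous f x) -> RInt (fun t => f (S - t)) a S = RInt f 0 (S - a).
Proof.
  intros Hf; assert (E := RInt_affine f (-1) S a S Hf).
  rewrite (RInt_ext _ (fun t => f (S - t))) in E by (intros; f_equal; as_R; ring).
  replace (-1 * S + S) with 0 in E by ring; replace (-1 * a + S) with (S - a) in E by ring.
  assert (E' := RInt_split f (S - a) 0 (S - a) Hf).
  rewrite RInt_point in E'; change zero with 0 in E'; lra.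
Qed.

Lemma solves_exists (k1 k2 kC beta : R) :
  0 <= k1 < kC -> 0 <= k2 < kC -> 0 < beta < PI -> exists prm, solves k1 k2 kC beta prm.
Proof.
  intros Hk1 Hk2 Hb.
  destruct (apex_exists k1 k2 kC beta Hk1 Hk2 Hb) as (b & k & Hbb & Hk & EG & EH).
  set (L1 := 2 * b / (k1 + k)); set (L2 := 2 * (beta - b) / (k2 + k)).
  set (d1 := (k - k1) / L1); set (d2 := (k - k2) / L2).
  assert (HL1 : 0 < L1) by (apply Rdiv_lt_0_compat; lra).
  assert (HL2 : 0 < L2) by (apply Rdiv_lt_0_compat; lra).
  assert (Hd1 : 0 < d1) by (apply Rdiv_lt_0_compat; lra).
  assert (Hd2 : 0 < d2) by (apply Rdiv_lt_0_compat; lra).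
  assert (Ek1 : k1 + d1 * L1 = k) by (unfold d1; field; lra).
  assert (Ek2 : k2 + d2 * L2 = k) by (unfold d2; field; lra).
  assert (Eb1 : k1 * L1 + d1 * L1 ^ 2 / 2 = b).
  { replace (_ + _) with (L1 * (k1 + (k1 + d1 * L1)) / 2) by field; rewrite Ek1; unfold L1; field; lra. }
  assert (Eb2 : k2 * L2 + d2 * L2 ^ 2 / 2 = beta - b).
  { replace (_ + _) with (L2 * (k2 + (k2 + d2 * L2)) / 2) by field; rewrite Ek2; unfold L2; field; lra. }
  exists (d1, d2, L1, L1 + L2).
  assert (HM : 0 < L1 < L1 + L2) by lra.
  assert (Hj : k1 + d1 * L1 = k2 + d2 * (L1 + L2 - L1)).
  { replace (L1 + L2 - L1) with L2 by ring; lra. }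
  set (T := turn (clothoid_pair_curv k1 k2 d1 d2 L1 (L1 + L2))).
  assert (ET : T (L1 + L2) = beta).
  { assert (E := turn_second _ _ _ _ _ _ HM Hj L1 (Rle_refl _)); fold T in E.
    unfold T in E at 1; rewrite turn_first, Eb1 in E by lra.
    replace (L1 + L2 - L1) with L2 in E by ring; lra. }
  assert (CT := continuous_turn_comp _ _ _ _ _ _ Hj); fold T in CT.
  (* The second arc is read backwards, so its angle is counted down from [beta]. *)
  assert (Split : forall f, (forall x, continuous f x) ->
    (forall x, continuous (fun y => f (beta - y)) x) ->
    RInt (fun t => f (T t)) 0 (L1 + L2) = arc_int f k1 b k + arc_int (fun y => f (beta - y)) k2 (beta - b) k).
  { intros f Hf Hf'; rewrite (RInt_split _ 0 L1 (L1 + L2)) by (apply CT, Hf); f_equal.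
    - rewrite <- Ek1, <- Eb1, arc_int_unscaled by (auto; lra).
      apply RInt_ext; intros x; rewrite Rmin_left, Rmax_right by lra; intros Hx.
      unfold T; rewrite turn_first by lra; auto.
    - rewrite <- Ek2, <- Eb2, arc_int_unscaled by (auto; lra).
      replace L2 with (L1 + L2 - L1) at 2 by ring.
      rewrite <- (RInt_reflect (fun t => f (beta - (k2 * t + d2 * t ^ 2 / 2))) (L1 + L2) L1).
      + apply RInt_ext; intros x; rewrite Rmin_left, Rmax_right by lra; intros Hx.
        unfold T; rewrite (turn_second _ _ _ _ _ _ HM Hj) by lra; fold T; rewrite ET; auto.
      + intros x; apply (continuous_quad_comp (fun y => f (beta - y))); auto. }
  assert (EX : RInt (fun t => cos (T t - beta / 2)) 0 (L1 + L2) = 2 * sin (beta / 2) / kC).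
  { rewrite (Split (fun y => cos (y - beta / 2))).
    - rewrite <- EG; f_equal; apply arc_int_ext; intros y.
      + rewrite <- cos_neg; f_equal; field.
      + f_equal; field.
    - intros x; apply (is_derive_continuous _ x (- sin (x - beta / 2))); auto_derive; auto; unfold Rminus, Rdiv; ring.
    - intros x; apply (is_derive_continuous _ x (sin (beta - x - beta / 2))); auto_derive; auto; unfold Rminus, Rdiv; ring. }
  assert (EY : RInt (fun t => sin (T t - beta / 2)) 0 (L1 + L2) = 0).
  { rewrite (Split (fun y => sin (y - beta / 2))).
    - rewrite (arc_int_ext _ (fun y => - sin (-1 * y + beta / 2)) k1), arc_int_opp, EH.
      + rewrite (arc_int_ext (fun y => sin (beta - y - beta / 2)) (fun y => sin (-1 * y + beta / 2))).
        * as_R; ring.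
        * intros y; f_equal; field.
      + intros; apply continuous_sin_affine.
      + intros y; rewrite <- sin_neg; f_equal; field.
    - intros x; apply (is_derive_continuous _ x (cos (x - beta / 2))); auto_derive; auto; unfold Rminus, Rdiv; ring.
    - intros x; apply (is_derive_continuous _ x (- cos (beta - x - beta / 2))); auto_derive; auto; unfold Rminus, Rdiv; ring. }
  split; [repeat split; try lra; auto|split; [lra|]].
  intros v; rewrite RInt_sin_affine by lra.
  (* Any phase is a combination of the two components relative to the chord, which [EX] and [EY]
     give. *)
  rewrite (RInt_ext _ (fun t => cos (v + beta / 2) * sin (T t - beta / 2) + sin (v + beta / 2) * cos (T t - beta / 2))).
  2: { intros t _; fold T; rewrite Rmult_comm, (Rmult_comm (sin (v + _))), <- sin_plus; f_equal; as_R; field. }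
  rewrite RInt_lin, EX, EY.
  - as_R; set (w := v + beta / 2).
    replace (kC * 0 + v) with (w - beta / 2) by (unfold w; ring).
    replace (kC * (beta / kC) + v) with (w + beta / 2) by (unfold w; field; lra).
    rewrite cos_minus, cos_plus; field; lra.
  - apply (CT (fun y => sin (y - beta / 2))); intros x.
    apply (is_derive_continuous _ x (cos (x - beta / 2))); auto_derive; auto; unfold Rminus, Rdiv; ring.
  - apply (CT (fun y => cos (y - beta / 2))); intros x.
    apply (is_derive_continuous _ x (- sin (x - beta / 2))); auto_derive; auto; unfold Rminus, Rdiv; ring.
Qed.

(** * Position relative to the circle *)

Lemma RInt_sin_shift (g : R -> R) (v a b : R) :
  (forall x, continuous g x) ->
  RInt (fun t => sin (g t + v)) a b =
  cos v * RInt (fun t => sin (g t)) a b + sin v * RInt (fun t => cos (g t)) a b.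
Proof.
  intros Hg; rewrite <- RInt_lin.
  - apply RInt_ext; intros; rewrite sin_plus; as_R; ring.
  - intros x; apply (continuous_comp g sin); auto; apply continuous_sin.
  - intros x; apply (continuous_comp g cos); auto; apply continuous_cos.
Qed.

Section Zone.
Variables k1 k2 kC beta d1 d2 sM sF : R.
Hypothesis Hk1 : 0 <= k1 < kC.
Hypothesis Hk2 : 0 <= k2 < kC.
Hypothesis Hbeta : 0 < beta < PI.
Hypothesis HS : solves k1 k2 kC beta (d1, d2, sM, sF).
Notation K := (clothoid_pair_curv k1 k2 d1 d2 sM sF).
Notation T := (turn K).

Let HT : tent k1 k2 beta d1 d2 sM sF.
Proof. exact (proj1 HS). Qed.

Let Hj : k1 + d1 * sM = k2 + d2 * (sF - sM).
Proof. apply HT. Qed.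

Let HM : 0 < sM < sF.
Proof. apply HT. Qed.

Let Tc (x : R) : continuous T x.
Proof. apply continuous_turn, Hj. Qed.

Let sin_c (c t : R) : sin (c - t) = sin (t + (PI - c)).
Proof. replace (t + (PI - c)) with (PI - (c - t)) by ring; symmetry; apply sin_PI_x. Qed.

(** The curve at arc length [s] is compared with the circle at the point of equal tangent angle
    [T s]. *)
Lemma excess_gint (v s : R) : 0 <= s <= sF ->
  gint (fun y => sin (y + v) * (dens k1 k2 beta d1 d2 y - / kC)) 0 (T s)
    (RInt (fun t => sin (T t + v)) 0 s - / kC * RInt (fun y => sin (y + v)) 0 (T s)).
Proof.
  intros Hs.
  assert (C := continuous_sin_shift v).
  eapply gint_ext; [|apply gint_minus; [apply (tent_gint _ _ _ _ _ _ _ HT (fun y => sin (y + v)) s C Hs)|apply gint_RInt, C]].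
  intros; simpl; ring.
Qed.

Lemma excess_total (v : R) :
  gint (fun y => sin (y + v) * (dens k1 k2 beta d1 d2 y - / kC)) 0 beta 0.
Proof.
  assert (G := excess_gint v sF); destruct HS as (_ & _ & E); rewrite E in G.
  replace (T sF) with beta in G by (symmetry; apply HT).
  assert (A := RInt_affine _ kC 0 0 (beta / kC) (continuous_sin_shift v)).
  replace (kC * 0 + 0) with 0 in A by ring; replace (kC * (beta / kC) + 0) with beta in A by (field; lra).
  rewrite (RInt_ext _ (fun t => sin (kC * t + v))) in A by (intros; f_equal; as_R; ring).
  replace 0 with (RInt (fun t => sin (kC * t + v)) 0 (beta / kC) -
    / kC * RInt (fun y => sin (y + v)) 0 beta) at 2; [apply G; lra|].
  etransitivity; [apply f_equal, f_equal; symmetry; exact A|]; as_R; field; lra.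
Qed.

(** The angles at which the rising and the falling side of the tent cross the level [kC ^ 2]; the
    apex lies between them. *)
Let z1 := (kC ^ 2 - k1 ^ 2) / (2 * d1).
Let z2 := beta - (kC ^ 2 - k2 ^ 2) / (2 * d2).

Lemma excess_signs :
  0 < z1 /\ z1 < z2 /\ z2 < beta /\
  (forall y, 0 < y < z1 -> 0 <= dens k1 k2 beta d1 d2 y - / kC) /\
  (forall y, z1 < y < z2 -> dens k1 k2 beta d1 d2 y - / kC <= 0) /\
  (forall y, z2 < y < beta -> 0 <= dens k1 k2 beta d1 d2 y - / kC).
Proof.
  destruct (tent_apex _ _ _ _ _ _ _ HT) as [A1 A2].
  destruct HT as (_ & _ & D1 & D2 & _); destruct HS as (_ & HkM & _).
  set (b := T sM) in *.
  assert (Q : kC ^ 2 < (k1 + d1 * sM) ^ 2) by (assert (0 < k1 + d1 * sM) by lra; nra).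
  assert (E1 : k1 ^ 2 + 2 * d1 * z1 = kC ^ 2) by (unfold z1; field; lra).
  assert (E2 : k2 ^ 2 + 2 * d2 * (beta - z2) = kC ^ 2) by (unfold z2; field; lra).
  assert (P1 : k1 ^ 2 < kC ^ 2) by nra.
  assert (P2 : k2 ^ 2 < kC ^ 2) by nra.
  assert (Z1 : 0 < z1) by nra.
  assert (Z2 : z2 < beta) by nra.
  assert (Z1b : z1 < b) by nra.
  assert (Z2b : b < z2) by nra.
  assert (Er : / kC = / sqrt (kC ^ 2)) by (rewrite sqrt_pow2 by lra; auto).
  rewrite Er.
  assert (Above : forall y, 0 < y < beta ->
    k1 ^ 2 + 2 * d1 * y <= kC ^ 2 \/ k2 ^ 2 + 2 * d2 * (beta - y) <= kC ^ 2 ->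
    0 <= dens k1 k2 beta d1 d2 y - / sqrt (kC ^ 2)).
  { intros y Hy H; apply Rge_le, Rge_minus, Rle_ge, inv_sqrt_le; split; [apply Rmin_pos_dens; auto|].
    destruct H; [eapply Rle_trans; [apply Rmin_l|]|eapply Rle_trans; [apply Rmin_r|]]; assumption. }
  repeat split; auto; try lra.
  - intros y Hy; apply Above; [lra|left; nra].
  - intros y Hy; apply Rle_minus, inv_sqrt_le; split; [nra|].
    apply Rmin_glb; nra.
  - intros y Hy; apply Above; [lra|right; nra].
Qed.

Notation X s := (RInt (fun r => cos (T r)) 0 s).
Notation Y s := (RInt (fun r => sin (T r)) 0 s).

(** The support function of the clothoid curve dominates that of the circle. *)
Lemma support_ge (s : R) : 0 <= s <= sF ->
  (1 - cos (T s)) / kC <= X s * sin (T s) - Y s * cos (T s).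
Proof.
  intros Hs; set (th := T s).
  assert (Hth : 0 <= th <= beta) by (apply (tent_turn_bounds _ _ _ _ _ _ _ HT); auto).
  destruct excess_signs as (Z1 & Z12 & Z2 & S1 & S2 & S3).
  (* [E c] integrates the excess density against [sin (c - y)] over [[0, th]]. The total over
     [[0, beta]] is zero, so [- E c] is the integral over the rest. At [c = th] it is the difference
     of the support functions. *)
  set (E := fun c => RInt (fun t => sin (T t + (PI - c))) 0 s - / kC * RInt (fun y => sin (y + (PI - c))) 0 th).
  assert (G : forall c, gint (fun y => sin (c - y) * (dens k1 k2 beta d1 d2 y - / kC)) 0 th (E c)).
  { intros c; eapply gint_ext, (excess_gint (PI - c) s Hs); intros y _; rewrite (sin_c c y); auto. }
  assert (G' : forall c, gint (fun y => sin (c - y) * (dens k1 k2 beta d1 d2 y - / kC)) th beta (- E c)).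
  { intros c; replace (- E c) with (0 - E c) by ring; apply gint_tail with 0; auto.
    eapply gint_ext, (excess_total (PI - c)); intros y _; rewrite (sin_c c y); auto. }
  assert (Lin : forall c, E c = sin c * (X s - / kC * sin th) - cos c * (Y s - / kC * (1 - cos th))).
  { intros c; unfold E; rewrite RInt_sin_shift by apply Tc.
    rewrite (RInt_sin_shift (fun y => y)) by (intros; apply continuous_id).
    rewrite (RInt_ext (fun t => sin t) (fun t => sin (1 * t + 0))) by (intros; f_equal; as_R; ring).
    rewrite (RInt_ext (fun t => cos t) (fun t => cos (1 * t + 0))) by (intros; f_equal; as_R; ring).
    rewrite RInt_sin_affine, RInt_cos_affine by lra.
    replace (1 * 0 + 0) with 0 by ring; replace (1 * th + 0) with th by ring.
    rewrite sin_0, cos_0, Rminus_0_r, sin_PI_x, cos_minus, cos_PI, sin_PI.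
    as_R; field; lra. }
  cut (0 <= E th).
  { rewrite Lin; intros H; assert (P := sin2_cos2 th); unfold Rsqr in P.
    replace (sin th * _ - _) with
      (X s * sin th - Y s * cos th - (sin th * sin th + cos th * cos th - cos th) * / kC) in H by ring.
    rewrite P in H; unfold Rdiv; lra. }
  (* In the outer two cases the excess is nonnegative on all of [[0, th]], respectively
     [[th, beta]], and [sin (th - y)] has constant sign there. *)
  destruct (Rle_lt_dec th z1) as [H1|H1]; [|destruct (Rle_lt_dec z2 th) as [H2|H2]].
  - apply (gint_nonneg _ 0 th (E th)) in G; auto; [lra|].
    intros y Hy; apply Rmult_le_pos; [apply sin_ge_0; lra|apply S1; lra].
  - cut (0 <= - - E th); [lra|].
    apply (gint_nonneg (fun y => - (sin (th - y) * (dens k1 k2 beta d1 d2 y - / kC))) th beta);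
      [lra| |apply gint_opp, G'].
    intros y Hy; assert (0 <= dens k1 k2 beta d1 d2 y - / kC) by (apply S3; lra).
    assert (0 <= sin (y - th)) by (apply sin_ge_0; lra).
    replace (th - y) with (- (y - th)) by ring; rewrite sin_neg; nra.
  - (* [sin (th - y)] is a nonnegative combination of the sines vanishing at [z1] and [z2]. *)
    assert (I : sin (z2 - z1) * E th = sin (th - z1) * E z2 + sin (z2 - th) * E z1).
    { rewrite !Lin, !sin_minus; ring. }
    assert (E1 : 0 <= E z1).
    { apply (gint_nonneg _ 0 th _ ltac:(lra)) with (2 := G z1); intros y Hy.
      destruct (Rtotal_order y z1) as [H|[H|H]].
      - apply Rmult_le_pos; [apply sin_ge_0; lra|apply S1; lra].
      - rewrite H, Rminus_diag, sin_0; lra.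
      - assert (0 <= sin (y - z1)) by (apply sin_ge_0; lra).
        replace (z1 - y) with (- (y - z1)) by ring; rewrite sin_neg.
        assert (dens k1 k2 beta d1 d2 y - / kC <= 0) by (apply S2; lra); nra. }
    assert (E2 : 0 <= - - E z2).
    { apply (gint_nonneg _ th beta _ ltac:(lra)) with (2 := gint_opp _ _ _ _ (G' z2)); intros y Hy.
      destruct (Rtotal_order y z2) as [H|[H|H]].
      - assert (0 <= sin (z2 - y)) by (apply sin_ge_0; lra).
        assert (dens k1 k2 beta d1 d2 y - / kC <= 0) by (apply S2; lra); nra.
      - rewrite H, Rminus_diag, sin_0; lra.
      - assert (0 <= sin (y - z2)) by (apply sin_ge_0; lra).
        replace (z2 - y) with (- (y - z2)) by ring; rewrite sin_neg.
        assert (0 <= dens k1 k2 beta d1 d2 y - / kC) by (apply S3; lra); nra. }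
    assert (0 < sin (z2 - z1)) by (apply sin_gt_0; lra).
    assert (0 <= sin (th - z1)) by (apply sin_ge_0; lra).
    assert (0 <= sin (z2 - th)) by (apply sin_ge_0; lra).
    assert (0 <= sin (th - z1) * E z2) by (apply Rmult_le_pos; lra).
    assert (0 <= sin (z2 - th) * E z1) by (apply Rmult_le_pos; lra).
    nra.
Qed.
Let Cs (v x : R) : continuous (fun t : R => sin (T t + v)) x.
Proof. apply (continuous_comp T (fun y => sin (y + v))); [apply Tc|apply continuous_sin_shift]. Qed.

Lemma chord_coords : X sF = sin beta / kC /\ Y sF = (1 - cos beta) / kC.
Proof.
  destruct HS as (_ & _ & E).
  assert (Shift := fun v => RInt_sin_shift T v 0 sF Tc).
  split.
  - assert (E1 := E (PI / 2)); rewrite Shift, RInt_sin_affine in E1 by lra.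
    rewrite !cos_plus, cos_PI2, sin_PI2 in E1.
    replace (kC * (beta / kC)) with beta in E1 by (field; lra).
    replace (kC * 0) with 0 in E1 by ring; rewrite sin_0 in E1; lra.
  - assert (E1 := E 0); rewrite Shift, RInt_sin_affine in E1 by lra.
    rewrite !Rplus_0_r, cos_0, sin_0 in E1.
    replace (kC * (beta / kC)) with beta in E1 by (field; lra).
    replace (kC * 0) with 0 in E1 by ring; rewrite cos_0 in E1; lra.
Qed.

Lemma turn_monotone (s t : R) : 0 <= s -> s <= t -> t <= sF -> T s <= T t.
Proof.
  intros H0 Hst Ht; destruct HT as (_ & _ & D1 & D2 & _).
  assert (CK := clothoid_continuous _ _ _ _ _ _ Hj).
  unfold turn; rewrite (RInt_split K 0 s t) by exact CK.
  cut (0 <= RInt K s t); [lra|].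
  apply RInt_ge_0; [lra|apply continuous_ex_RInt, CK|].
  intros x Hx; unfold clothoid_pair_curv; destruct Rle_dec.
  - assert (0 <= d1 * x) by (apply Rmult_le_pos; lra); lra.
  - assert (0 <= d2 * (sF - x)) by (apply Rmult_le_pos; lra); lra.
Qed.

Lemma tail_integral (v s : R) :
  RInt (fun t => sin (T t + v)) s sF =
  cos v * ((1 - cos beta) / kC - Y s) + sin v * (sin beta / kC - X s).
Proof.
  assert (A := RInt_split _ 0 s sF (Cs v)).
  rewrite !(RInt_sin_shift T v 0) in A by exact Tc.
  destruct chord_coords as [EX EY]; rewrite EX, EY in A. as_R; lra.
Qed.

(** These are the sides of the triangle bounded by the two end tangents and the chord. The first two
    hold because the tangent angle stays in [[0, beta]], the second being read off the part of the
    curve still to come. *)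
Lemma coords_in_triangle (s : R) : 0 <= s <= sF ->
  0 <= Y s /\ X s * sin beta - Y s * cos beta <= (1 - cos beta) / kC /\
  Y s * cos (beta / 2) <= X s * sin (beta / 2).
Proof.
  intros Hs.
  assert (TB := fun t => tent_turn_bounds _ _ _ _ _ _ _ HT t).
  split; [|split].
  - apply RInt_ge_0; [lra| |].
    + apply continuous_ex_RInt; intros x; apply (continuous_comp T sin); [apply Tc|apply continuous_sin].
    + intros x Hx; specialize (TB x ltac:(lra)); apply sin_ge_0; lra.
  - assert (A : 0 <= RInt (fun t => sin (T t + (PI - beta))) s sF).
    { apply RInt_ge_0; [lra|apply continuous_ex_RInt, Cs|].
      intros x Hx; specialize (TB x ltac:(lra)); apply sin_ge_0; lra. }
    rewrite tail_integral, sin_PI_x, cos_minus, cos_PI, sin_PI in A.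
    assert (P := sin2_cos2 beta); unfold Rsqr in P.
    assert (E : (-1 * cos beta + 0 * sin beta) * ((1 - cos beta) / kC - Y s) + sin beta * (sin beta / kC - X s)
      = (sin beta * sin beta + cos beta * cos beta - cos beta) / kC + Y s * cos beta - X s * sin beta)
      by (field; lra).
    rewrite E, P in A; lra.
  - (* The integrand changes sign once, so whichever of the two halves has constant sign decides. *)
    assert (A0 : RInt (fun t => sin (T t + - (beta / 2))) 0 sF = 0).
    { destruct HS as (_ & _ & E); rewrite E, RInt_sin_affine by lra.
      replace (kC * 0 + - (beta / 2)) with (- (beta / 2)) by ring; rewrite cos_neg.
      replace (kC * (beta / kC) + - (beta / 2)) with (beta / 2) by (field; lra).
      as_R; field; lra. }
    assert (A : 0 <= RInt (fun t => sin (T t + - (beta / 2))) s sF).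
    { destruct (Rle_lt_dec (beta / 2) (T s)) as [H|H].
      - apply RInt_ge_0; [lra|apply continuous_ex_RInt, Cs|].
        intros x Hx; assert (M := turn_monotone s x); specialize (TB x ltac:(lra)); apply sin_ge_0; lra.
      - rewrite (RInt_split _ 0 s sF (Cs (- (beta / 2)))) in A0.
        assert (B : RInt (fun t => sin (T t + - (beta / 2))) 0 s <= RInt (fun _ => 0) 0 s).
        { apply RInt_le; [lra|apply continuous_ex_RInt, Cs|apply continuous_ex_RInt; intros; apply continuous_const|].
          intros x Hx; assert (M := turn_monotone x s); specialize (TB x ltac:(lra)).
          rewrite <- sin_0; apply sin_incr_1; lra. }
        rewrite RInt_const in B; unfold scal in B; simpl in B; unfold mult in B; simpl in B; lra. }
    rewrite tail_integral, cos_neg, sin_neg in A.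
    assert (E : cos (beta / 2) * (1 - cos beta) - sin (beta / 2) * sin beta = 0).
    { assert (Q := cos_minus beta (beta / 2)); replace (beta - beta / 2) with (beta / 2) in Q by field; lra. }
    assert (E' : cos (beta / 2) * ((1 - cos beta) / kC - Y s) + - sin (beta / 2) * (sin beta / kC - X s)
      = (cos (beta / 2) * (1 - cos beta) - sin (beta / 2) * sin beta) / kC
        + X s * sin (beta / 2) - Y s * cos (beta / 2)) by (field; lra).
    rewrite E', E in A; lra.
Qed.

(** The circle has centre [(0, 1 / kC)]. By [support_ge] the vector from the centre to the curve has
    a component of at least the radius along the normal [(sin th, - cos th)]. *)
Lemma coords_outside_circle (s : R) : 0 <= s <= sF -> 0 <= X s ^ 2 + Y s ^ 2 - 2 * Y s / kC.
Proof.
  intros Hs; assert (A := support_ge s Hs); set (th := T s) in *.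
  assert (P := sin2_cos2 th); unfold Rsqr in P.
  set (r := / kC); assert (Hr : 0 < r) by (apply Rinv_0_lt_compat; lra).
  unfold Rdiv in *; fold r; fold r in A.
  assert (H : r <= X s * sin th - (Y s - r) * cos th) by lra.
  assert (E : X s ^ 2 + (Y s - r) ^ 2 =
    (X s * sin th - (Y s - r) * cos th) ^ 2 + (X s * cos th + (Y s - r) * sin th) ^ 2).
  { replace (X s ^ 2 + _) with ((X s ^ 2 + (Y s - r) ^ 2) * (sin th * sin th + cos th * cos th))
      by (rewrite P; ring); ring. }
  assert (0 <= (X s * cos th + (Y s - r) * sin th) ^ 2) by apply pow2_ge_0.
  assert (r ^ 2 <= (X s * sin th - (Y s - r) * cos th) ^ 2) by (apply pow_incr; lra).
  lra.
Qed.
End Zone.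

(** * Geometry of the corner *)

Lemma vnorm_scal (m a b : R) : 0 <= m -> a ^ 2 + b ^ 2 = 1 -> vnorm (m * a, m * b) = m.
Proof.
  intros Hm E; unfold vnorm, vdot; simpl.
  replace (_ + _) with (m ^ 2 * (a ^ 2 + b ^ 2)) by ring; rewrite E, Rmult_1_r; apply sqrt_pow2, Hm.
Qed.

Lemma vnorm_pos (u : pt) : u <> (0, 0) -> 0 < vnorm u.
Proof.
  destruct u as [x y]; intros H; apply sqrt_lt_R0; unfold vdot; simpl.
  destruct (Req_dec x 0) as [->|Hx]; [destruct (Req_dec y 0) as [->|Hy]|]; [tauto|nra|nra].
Qed.

Lemma vnorm_sq (u : pt) : vnorm u * vnorm u = vdot u u.
Proof. apply sqrt_sqrt; unfold vdot; nra. Qed.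

Lemma corner_frame (p0 p1 p2 : pt) (beta : R) :
  signed_angle (vsub p1 p0) (vsub p2 p1) beta ->
  exists a b m l, a ^ 2 + b ^ 2 = 1 /\ 0 < m /\ 0 < l /\
    vsub p1 p0 = (m * a, m * b) /\
    vsub p2 p1 = (l * (a * cos beta - b * sin beta), l * (b * cos beta + a * sin beta)).
Proof.
  intros (Hu & Hv & _ & Hc & Hs).
  assert (Pu := vnorm_pos _ Hu); assert (Pv := vnorm_pos _ Hv).
  assert (Su := vnorm_sq (vsub p1 p0)).
  destruct (vsub p1 p0) as [x y], (vsub p2 p1) as [z w].
  set (m := vnorm (x, y)) in *; set (l := vnorm (z, w)) in *.
  unfold vdot, vcross in Su, Hc, Hs; simpl in Su, Hc, Hs.
  exists (x / m), (y / m), m, l; repeat split; auto.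
  - replace ((x / m) ^ 2 + (y / m) ^ 2) with ((x * x + y * y) / (m * m)) by (field; lra).
    rewrite <- Su; field; lra.
  - f_equal; field; lra.
  - assert (E1 : l * (x * cos beta - y * sin beta) * m = z * (m * m)).
    { replace (_ * m) with (x * (cos beta * (m * l)) - y * (sin beta * (m * l))) by ring.
      rewrite Hc, Hs, Su; ring. }
    assert (E2 : l * (y * cos beta + x * sin beta) * m = w * (m * m)).
    { replace (_ * m) with (y * (cos beta * (m * l)) + x * (sin beta * (m * l))) by ring.
      rewrite Hc, Hs, Su; ring. }
    f_equal; apply Rmult_eq_reg_r with (m * m); try nra.
    + rewrite <- E1; field; lra.
    + rewrite <- E2; field; lra.
Qed.

Section Corner.
Variables (p0 p1 p2 : pt) (clr : option R) (beta a b m l : R).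
Hypothesis Hab : a ^ 2 + b ^ 2 = 1.
Hypothesis Hm : 0 < m.
Hypothesis Hl : 0 < l.
Hypothesis Eu : vsub p1 p0 = (m * a, m * b).
Let e := a * cos beta - b * sin beta.
Let f := b * cos beta + a * sin beta.
Hypothesis Ev : vsub p2 p1 = (l * e, l * f).
Hypothesis Hclr : valid_clearance clr.
Hypothesis Hbeta : 0 < beta < PI.

Let c := eff_clearance p0 p1 p2 clr.

Let trig : sin beta * sin beta + cos beta * cos beta = 1.
Proof. exact (sin2_cos2 beta). Qed.

Let sin_pos : 0 < sin beta.
Proof. apply sin_gt_0; lra. Qed.

Let Hef : e ^ 2 + f ^ 2 = 1.
Proof.
  replace (e ^ 2 + f ^ 2) with ((a ^ 2 + b ^ 2) * (sin beta * sin beta + cos beta * cos beta))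
    by (unfold e, f; ring); rewrite Hab, trig; ring.
Qed.

Let dot_uv : a * e + b * f = cos beta.
Proof. replace (_ + _) with ((a ^ 2 + b ^ 2) * cos beta) by (unfold e, f; ring); rewrite Hab; ring. Qed.

Let cross_uv : a * f - b * e = sin beta.
Proof. replace (_ - _) with ((a ^ 2 + b ^ 2) * sin beta) by (unfold e, f; ring); rewrite Hab; ring. Qed.

Lemma clearance_pos : 0 < c.
Proof.
  unfold c, eff_clearance; destruct clr; [exact Hclr|].
  rewrite Eu, Ev, !vnorm_scal by (lra || auto); apply Rmin_glb_lt; auto.
Qed.

Let tang1E : tang1 p0 p1 p2 clr = (fst p1 - c * a, snd p1 - c * b).
Proof.
  unfold tang1; rewrite Eu, vnorm_scal by (lra || auto); fold c; simpl; f_equal; field; lra.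
Qed.

Let tang2E : tang2 p0 p1 p2 clr = (fst p1 + c * e, snd p1 + c * f).
Proof.
  unfold tang2; rewrite Ev, vnorm_scal by (lra || auto); fold c; simpl; f_equal; field; lra.
Qed.

(** Oblique coordinates along the two segments, measured from the corner; [x] runs backwards
    along the first segment. *)
Definition corner_pt (x y : R) : pt := (fst p1 - x * a + y * e, snd p1 - x * b + y * f).

Lemma corner_pt_inj (x y x' y' : R) : corner_pt x y = corner_pt x' y' -> x = x' /\ y = y'.
Proof.
  intros E; apply (f_equal fst) in E as E1; apply (f_equal snd) in E as E2.
  unfold corner_pt in E1, E2; simpl in E1, E2.
  assert (D1 : (x - x') * (a * f - b * e) = 0).
  { replace (_ * _) with (- f * (- x * a + y * e - (- x' * a + y' * e)) + e * (- x * b + y * f - (- x' * b + y' * f))) by ring.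
    replace (- x * a + y * e - (- x' * a + y' * e)) with 0 by lra.
    replace (- x * b + y * f - (- x' * b + y' * f)) with 0 by lra. ring. }
  assert (D2 : (y - y') * (a * f - b * e) = 0).
  { replace (_ * _) with (- b * (- x * a + y * e - (- x' * a + y' * e)) + a * (- x * b + y * f - (- x' * b + y' * f))) by ring.
    replace (- x * a + y * e - (- x' * a + y' * e)) with 0 by lra.
    replace (- x * b + y * f - (- x' * b + y' * f)) with 0 by lra. ring. }
  rewrite cross_uv in D1, D2.
  apply Rmult_integral in D1, D2; split; destruct D1, D2; lra.
Qed.

(** The term added to [r ^ 2] is the power of the point with respect to the disk; on each axis it is
    the square of the distance to the point of tangency. *)
Let disk_power (o : pt) (r x y : R) : is_safe_disk p0 p1 p2 clr o r ->
  vdot (vsub (corner_pt x y) o) (vsub (corner_pt x y) o) =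
  r ^ 2 + (x ^ 2 + y ^ 2 - 2 * x * y * cos beta - 2 * c * (x + y) + c ^ 2).
Proof.
  intros (Hr & O1 & O2 & N1 & _).
  assert (Hr2 : vdot (vsub o (tang1 p0 p1 p2 clr)) (vsub o (tang1 p0 p1 p2 clr)) = r ^ 2)
    by (rewrite <- vnorm_sq, N1; ring).
  rewrite tang1E in O1, Hr2; rewrite tang2E in O2; rewrite Eu in O1; rewrite Ev in O2.
  unfold vdot, vsub, corner_pt in *; cbn [fst snd] in *.
  set (q1 := fst o - fst p1) in *; set (q2 := snd o - snd p1) in *.
  assert (U : q1 * a + q2 * b = - c).
  { apply Rmult_eq_reg_l with m; [|lra].
    replace (m * (q1 * a + q2 * b)) with ((fst o - (fst p1 - c * a)) * (m * a) + (snd o - (snd p1 - c * b)) * (m * b) - m * c * (a ^ 2 + b ^ 2))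
      by (unfold q1, q2; ring).
    rewrite O1, Hab; ring. }
  assert (V : q1 * e + q2 * f = c).
  { apply Rmult_eq_reg_l with l; [|lra].
    replace (l * (q1 * e + q2 * f)) with ((fst o - (fst p1 + c * e)) * (l * e) + (snd o - (snd p1 + c * f)) * (l * f) + l * c * (e ^ 2 + f ^ 2))
      by (unfold q1, q2; ring).
    rewrite O2, Hef; ring. }
  assert (Q : q1 ^ 2 + q2 ^ 2 = r ^ 2 + c ^ 2).
  { rewrite <- Hr2.
    replace ((fst o - (fst p1 - c * a)) * _ + _) with (q1 ^ 2 + q2 ^ 2 + 2 * c * (q1 * a + q2 * b) + c ^ 2 * (a ^ 2 + b ^ 2))
      by (unfold q1, q2; ring).
    rewrite U, Hab; ring. }
  replace (_ + _) with
    (x ^ 2 * (a ^ 2 + b ^ 2) + y ^ 2 * (e ^ 2 + f ^ 2) - 2 * x * y * (a * e + b * f)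
     + 2 * x * (q1 * a + q2 * b) - 2 * y * (q1 * e + q2 * f) + (q1 ^ 2 + q2 ^ 2))
    at 1 by (unfold q1, q2; ring).
  rewrite Hab, Hef, dot_uv, U, V, Q; ring.
Qed.

Lemma safe_zone_intro (x y : R) :
  0 <= x -> 0 <= y -> x + y <= c ->
  0 <= x ^ 2 + y ^ 2 - 2 * x * y * cos beta - 2 * c * (x + y) + c ^ 2 ->
  in_safe_zone p0 p1 p2 clr (corner_pt x y).
Proof.
  intros Hx Hy Hxy HQ; right; right; intros o r Ho.
  assert (Hc := clearance_pos); split.
  - exists (x / c), (1 - (x + y) / c), (y / c).
    repeat split.
    + apply Rdiv_le_0_compat; lra.
    + cut ((x + y) / c <= 1); [lra|]; apply Rle_div_l; lra.
    + apply Rdiv_le_0_compat; lra.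
    + field; lra.
    + rewrite tang1E, tang2E; unfold corner_pt; simpl; f_equal; field; lra.
  - assert (E := disk_power o r x y Ho); destruct Ho as [Hr _].
    rewrite <- (sqrt_pow2 r) by lra; apply sqrt_le_1.
    + apply pow2_ge_0.
    + rewrite E; assert (P := pow2_ge_0 r); lra.
    + rewrite E; lra.
Qed.

(** [in_safe_zone] quantifies universally over safe disks, so one must exist before anything can be
    extracted from it. The ratio [h] of radius to tangent length is the cotangent of [beta / 2]. *)
Lemma safe_disk_exists : exists o r, is_safe_disk p0 p1 p2 clr o r.
Proof.
  set (h := (1 + cos beta) / sin beta).
  assert (Hh : 0 < h) 
    by (apply Rdiv_lt_0_compat; auto; assert (cos PI < cos beta) by (apply cos_decreasing_1; lra);
        rewrite cos_PI in *; lra).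
  assert (Eh : h * sin beta = 1 + cos beta) by (unfold h; field; lra).
  assert (Hc := clearance_pos).
  exists (fst p1 - c * a - c * h * b, snd p1 - c * b + c * h * a), (c * h).
  assert (N : vnorm (c * h * - b, c * h * a) = c * h).
  { apply vnorm_scal; [|rewrite <- Hab; ring]; apply Rmult_le_pos; lra. }
  assert (O2 : vdot (vsub (fst p1 - c * a - c * h * b, snd p1 - c * b + c * h * a) (tang2 p0 p1 p2 clr)) (e, f) = 0).
  { rewrite tang2E; unfold vdot, vsub; simpl.
    replace (_ + _) with (c * (- (a * e + b * f) + h * (a * f - b * e) - (e ^ 2 + f ^ 2))) by ring.
    rewrite dot_uv, cross_uv, Hef, Eh; ring. }
  repeat split.
  - apply Rmult_lt_0_compat; auto.
  - rewrite tang1E, Eu; unfold vdot, vsub; simpl; ring.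
  - rewrite Ev; revert O2; generalize (vsub (fst p1 - c * a - c * h * b, snd p1 - c * b + c * h * a) (tang2 p0 p1 p2 clr)).
    unfold vdot; simpl; intros z O2; replace (_ + _) with (l * (fst z * e + snd z * f)) by ring; rewrite O2; ring.
  - etransitivity; [|exact N]; rewrite tang1E; f_equal; unfold vsub; simpl; f_equal; ring.
  - transitivity (sqrt ((c * h) ^ 2)); [|apply sqrt_pow2, Rmult_le_pos; lra].
    unfold vnorm; f_equal.
    revert O2; rewrite tang2E; unfold vdot, vsub; simpl fst; simpl snd; intros _.
    transitivity (c ^ 2 * ((a ^ 2 + b ^ 2) * (1 + h ^ 2) + (e ^ 2 + f ^ 2) + 2 * (a * e + b * f)
      - 2 * h * (a * f - b * e))); [ring|].
    rewrite Hab, Hef, dot_uv, cross_uv.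
    replace (2 * h * sin beta) with (2 * (h * sin beta)) by ring; rewrite Eh; ring.
Qed.

Lemma on_seg_first (x : pt) : on_seg p0 p1 x -> exists t, 0 <= t /\ x = corner_pt t 0.
Proof.
  intros (t & Ht & ->); exists ((1 - t) * m); split; [apply Rmult_le_pos; lra|].
  unfold vsub in Eu; injection Eu as E1 E2; unfold corner_pt; f_equal.
  - replace (fst p0) with (fst p1 - m * a) by lra; ring.
  - replace (snd p0) with (snd p1 - m * b) by lra; ring.
Qed.

Lemma on_seg_second (x : pt) : on_seg p1 p2 x -> exists t, 0 <= t /\ x = corner_pt 0 t.
Proof.
  intros (t & Ht & ->); exists (t * l); split; [apply Rmult_le_pos; lra|].
  unfold vsub in Ev; injection Ev as E1 E2; unfold corner_pt; f_equal.
  - replace (fst p2) with (fst p1 + l * e) by lra; ring.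
  - replace (snd p2) with (snd p1 + l * f) by lra; ring.
Qed.

Lemma safe_zone_elim (x y : R) :
  0 < x -> 0 < y -> in_safe_zone p0 p1 p2 clr (corner_pt x y) ->
  x + y <= c /\ 0 <= x ^ 2 + y ^ 2 - 2 * x * y * cos beta - 2 * c * (x + y) + c ^ 2.
Proof.
  intros Hx Hy [H|[H|H]].
  - apply on_seg_first in H as (t & _ & E); apply corner_pt_inj in E; lra.
  - apply on_seg_second in H as (t & _ & E); apply corner_pt_inj in E; lra.
  - destruct safe_disk_exists as (o & r & Ho); destruct (H o r Ho) as [(la & lb & lg & Ha & Hb & Hg & Hs & E) N].
    assert (Hc := clearance_pos); split.
    + assert (E' : corner_pt x y = corner_pt (la * c) (lg * c)).
      { rewrite E, tang1E, tang2E; unfold corner_pt; simpl.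
        replace lb with (1 - la - lg) by lra; f_equal; ring. }
      apply corner_pt_inj in E' as [-> ->]; nra.
    + assert (P := disk_power o r x y Ho); rewrite <- vnorm_sq in P; destruct Ho as [Hr _].
      assert (r ^ 2 <= vnorm (vsub (corner_pt x y) o) * vnorm (vsub (corner_pt x y) o)) by nra; lra.
Qed.

Lemma curve_pos_frame (k : R -> R) (t s : R) :
  (forall x, continuous (turn k) x) ->
  curve_pos (corner_pt t 0) (vsub p1 p0) k s =
  (fst p1 - t * a + (a * RInt (fun r => cos (turn k r)) 0 s - b * RInt (fun r => sin (turn k r)) 0 s),
   snd p1 - t * b + (b * RInt (fun r => cos (turn k r)) 0 s + a * RInt (fun r => sin (turn k r)) 0 s)).
Proof.
  intros Hk.
  assert (C : forall x, continuous (fun r => cos (turn k r)) x)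
    by (intros x; apply (continuous_comp (turn k) cos); [apply Hk|apply continuous_cos]).
  assert (S : forall x, continuous (fun r => sin (turn k r)) x)
    by (intros x; apply (continuous_comp (turn k) sin); [apply Hk|apply continuous_sin]).
  unfold curve_pos; rewrite Eu, vnorm_scal by (lra || auto); simpl fst; simpl snd.
  rewrite (RInt_ext _ (fun r => a * cos (turn k r) + - b * sin (turn k r)))
    by (intros; as_R; field; lra).
  rewrite (RInt_ext (fun r => (m * a * sin (turn k r) + m * b * cos (turn k r)) / m)
    (fun r => b * cos (turn k r) + a * sin (turn k r))) by (intros; as_R; field; lra).
  rewrite !RInt_lin by auto; f_equal; unfold corner_pt; simpl; ring.
Qed.

Lemma frame_oblique (t X Y : R) :
  (fst p1 - t * a + (a * X - b * Y), snd p1 - t * b + (b * X + a * Y)) =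
  corner_pt (t - X + Y * cos beta / sin beta) (Y / sin beta).
Proof. unfold corner_pt, e, f; f_equal; field; lra. Qed.
End Corner.

(** * Clothoid pairs inscribed in a corner *)

Lemma turn_const (k s : R) : turn (fun _ => k) s = k * s.
Proof. unfold turn; rewrite RInt_const; unfold scal; simpl; unfold mult; simpl; ring. Qed.

Lemma circle_coords (k s : R) : k <> 0 ->
  RInt (fun r => cos (turn (fun _ => k) r)) 0 s = sin (k * s) / k /\
  RInt (fun r => sin (turn (fun _ => k) r)) 0 s = (1 - cos (k * s)) / k.
Proof.
  intros Hk; split.
  - rewrite (RInt_ext _ (fun r => cos (k * r + 0))) by (intros; rewrite turn_const, Rplus_0_r; auto).
    rewrite RInt_cos_affine, !Rplus_0_r, Rmult_0_r, sin_0, Rminus_0_r by auto; auto.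
  - rewrite (RInt_ext _ (fun r => sin (k * r + 0))) by (intros; rewrite turn_const, Rplus_0_r; auto).
    rewrite RInt_sin_affine, !Rplus_0_r, Rmult_0_r, cos_0 by auto; auto.
Qed.

(** The power of a point with respect to the tangent circle, in oblique coordinates. *)
Lemma tangent_power (S C k t X Y : R) :
  S * S + C * C = 1 -> 0 < S -> 0 < k -> t * S = (1 - C) / k ->
  let x := t - X + Y * C / S in let y := Y / S in
  x ^ 2 + y ^ 2 - 2 * x * y * C - 2 * t * (x + y) + t ^ 2 = X ^ 2 + Y ^ 2 - 2 * Y / k.
Proof.
  intros P HS Hk Ht x y.
  assert (EY : Y = y * S) by (unfold y; field; lra).
  assert (EX : X = t - x + y * C) by (unfold x, y; field; lra).
  assert (Ek : S / k = t * (1 + C)).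
  { apply Rmult_eq_reg_r with S; [|lra].
    replace (t * (1 + C) * S) with (t * S * (1 + C)) by ring; rewrite Ht.
    replace (S / k * S) with (S * S / k) by (field; lra).
    replace (S * S) with (1 - C * C) by lra; field; lra. }
  replace (2 * Y / k) with (2 * y * (S / k)) by (rewrite EY; field; lra).
  rewrite Ek; clearbody x y; subst X Y.
  replace ((y * S) ^ 2) with (y ^ 2 * (1 - C * C)) by (rewrite <- P; ring); ring.
Qed.

Section Configuration.
Variables (p0 p1 p2 : pt) (clr : option R) (beta kC a b m l t LC : R).
Hypothesis Hab : a ^ 2 + b ^ 2 = 1.
Hypothesis Hm : 0 < m.
Hypothesis Hl : 0 < l.
Hypothesis Eu : vsub p1 p0 = (m * a, m * b).
Hypothesis Ev : vsub p2 p1 = (l * (a * cos beta - b * sin beta), l * (b * cos beta + a * sin beta)).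
Hypothesis Hclr : valid_clearance clr.
Hypothesis Hbeta : 0 < beta < PI.
Hypothesis HkC : 0 < kC.
Hypothesis Ht : 0 <= t.
Notation aC := (corner_pt p1 beta a b t 0).
Hypothesis Hint : interpolates p0 p1 p2 clr beta aC (fun _ => kC) LC.

Let trig : sin beta * sin beta + cos beta * cos beta = 1.
Proof. exact (sin2_cos2 beta). Qed.

Let sin_pos : 0 < sin beta.
Proof. apply sin_gt_0; lra. Qed.

Let c := eff_clearance p0 p1 p2 clr.

Lemma arc_length : LC = beta / kC.
Proof. destruct Hint as (_ & _ & _ & E & _); rewrite turn_const in E; rewrite <- E; field; lra. Qed.

Lemma curve_pos_oblique (k : R -> R) (s : R) :
  (forall x, continuous (turn k) x) ->
  let X := RInt (fun r => cos (turn k r)) 0 s in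
  let Y := RInt (fun r => sin (turn k r)) 0 s in
  curve_pos aC (vsub p1 p0) k s =
  corner_pt p1 beta a b (t - X + Y * cos beta / sin beta) (Y / sin beta).
Proof.
  intros Hk X Y; rewrite (curve_pos_frame p0 p1 beta a b m) by auto.
  apply frame_oblique; auto.
Qed.

Lemma turn_const_continuous (x : R) : continuous (turn (fun _ => kC)) x.
Proof.
  eapply is_derive_continuous, (is_derive_primitive (fun _ => kC)); intros; apply continuous_const.
Qed.

(** That is, [t] is [tan (beta / 2) / kC]: the arc ends on the second segment, where the first
    oblique coordinate vanishes. *)
Lemma tangent_length : t * sin beta = (1 - cos beta) / kC.
Proof.
  destruct Hint as (_ & _ & E & _).
  apply (on_seg_second p1 p2 beta a b l) in E as (z & _ & E); auto.
  rewrite curve_pos_oblique in E by exact turn_const_continuous.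
  destruct (circle_coords kC LC) as [EX EY]; [lra|].
  rewrite EX, EY, arc_length in E; replace (kC * (beta / kC)) with beta in E by (field; lra).
  apply corner_pt_inj in E as [E _]; auto.
  apply (f_equal (fun z => z * sin beta)) in E.
  replace (_ * _) with (t * sin beta - (sin beta * sin beta - (1 - cos beta) * cos beta) / kC) in E by (field; lra).
  replace (sin beta * sin beta) with (1 - cos beta * cos beta) in E by lra.
  replace (1 - cos beta * cos beta - (1 - cos beta) * cos beta) with (1 - cos beta) in E by ring.
  lra.
Qed.

(* The power of a point of the arc with respect to the disk tangent at distance [c] vanishes at
   [c = t]; being nonnegative at the midpoint of the arc, it forces [t <= c]. *)
Lemma tangent_length_le_clearance : t <= c.
Proof.
  assert (T := tangent_length).
  destruct (circle_coords kC (LC / 2)) as [EX EY]; [lra|].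
  replace (kC * (LC / 2)) with (beta / 2) in EX, EY by (rewrite arc_length; field; lra).
  assert (HLC : 0 < LC) by (rewrite arc_length; apply Rdiv_lt_0_compat; lra).
  destruct Hint as (_ & _ & _ & _ & Z).
  specialize (Z (LC / 2) ltac:(lra)).
  rewrite curve_pos_oblique, EX, EY in Z by exact turn_const_continuous.
  assert (P := tangent_power (sin beta) (cos beta) kC t (sin (beta / 2) / kC) ((1 - cos (beta / 2)) / kC) trig sin_pos HkC T).
  cbv zeta in P.
  set (h := cos (beta / 2)) in *; set (y := (1 - h) / kC / sin beta) in *.
  assert (Hh : 0 < h) by (apply cos_gt_0; lra).
  assert (Hh1 : h < 1) by (unfold h; rewrite <- cos_0; apply cos_decreasing_1; lra).
  assert (Hy : 0 < y) by (unfold y; apply Rdiv_lt_0_compat; auto; apply Rdiv_lt_0_compat; lra).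
  assert (D : cos beta = 2 * h * h - 1).
  { replace beta with (2 * (beta / 2)) by field; apply cos_2a_cos. }
  assert (Q : sin beta * sin (beta / 2) = h - h * cos beta).
  { assert (Q := cos_minus beta (beta / 2)); replace (beta - beta / 2) with (beta / 2) in Q by field.
    fold h in Q; lra. }
  (* The midpoint of the arc lies on the bisector, so its two oblique coordinates agree. *)
  assert (Ex : t - sin (beta / 2) / kC + (1 - h) / kC * cos beta / sin beta = y).
  { apply Rmult_eq_reg_r with (sin beta); [|lra].
    replace (_ * sin beta) with (t * sin beta - (sin beta * sin (beta / 2)) / kC + (1 - h) / kC * cos beta) by (field; lra).
    rewrite T, Q; unfold y; field; lra. }
  rewrite Ex in Z, P.
  destruct (safe_zone_elim p0 p1 p2 clr beta a b m l Hab Hm Hl Eu Ev Hclr Hbeta y y Hy Hy Z) as [Z1 Z2].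
  fold c in Z1, Z2.
  assert (P0 : (sin (beta / 2) / kC) ^ 2 + ((1 - h) / kC) ^ 2 - 2 * ((1 - h) / kC) / kC = 0).
  { assert (P2 := sin2_cos2 (beta / 2)); unfold Rsqr in P2; fold h in P2.
    replace (_ - _) with ((sin (beta / 2) * sin (beta / 2) + h * h - 1) / (kC * kC)) by (field; lra).
    rewrite P2; field; lra. }
  rewrite P0 in P.
  assert (Hyt : 2 * y < t).
  { apply Rmult_lt_reg_r with (sin beta); auto; rewrite T, D.
    replace (2 * y * sin beta) with (2 * (1 - h) * / kC) by (unfold y; field; lra).
    unfold Rdiv; apply Rmult_lt_compat_r; [apply Rinv_0_lt_compat; lra|nra]. }
  (* The difference of the powers for tangent lengths [c] and [t]. The second factor is positive,
     since [2 * y <= c] by [Z1] and [2 * y < t]. *)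
  assert (F : 0 <= (c - t) * (c + t - 4 * y)).
  { replace (_ * _) with ((y ^ 2 + y ^ 2 - 2 * y * y * cos beta - 2 * c * (y + y) + c ^ 2) -
      (y ^ 2 + y ^ 2 - 2 * y * y * cos beta - 2 * t * (y + y) + t ^ 2)) by ring; lra. }
  apply Rnot_lt_le; intros H; assert (0 < (t - c) * (c + t - 4 * y)) by (apply Rmult_lt_0_compat; lra); lra.
Qed.

Variables k1 k2 : R.
Hypothesis Hk1 : 0 <= k1 < kC.
Hypothesis Hk2 : 0 <= k2 < kC.

Lemma solves_good (prm : R * R * R * R) :
  solves k1 k2 kC beta prm -> good_clothoid_pair p0 p1 p2 clr beta kC aC LC k1 k2 prm.
Proof.
  destruct prm as [[[d1 d2] sM] sF]; intros HS; assert (HS' := HS).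
  destruct HS' as [HT [HkM _]].
  destruct HT as (_ & _ & _ & _ & HM & Hj & Hb).
  assert (CT := continuous_turn _ _ _ _ _ _ Hj).
  destruct (chord_coords k1 k2 kC beta d1 d2 sM sF Hk1 HS) as [EX EY].
  assert (Eend : curve_pos aC (vsub p1 p0) (clothoid_pair_curv k1 k2 d1 d2 sM sF) sF
    = curve_pos aC (vsub p1 p0) (fun _ => kC) LC).
  { rewrite !curve_pos_oblique by (exact CT || exact turn_const_continuous).
    destruct (circle_coords kC LC) as [-> ->]; [lra|]; rewrite EX, EY, arc_length.
    replace (kC * (beta / kC)) with beta by (field; lra); auto. }
  destruct Hint as (_ & HaC & Hend & _ & _).
  unfold good_clothoid_pair, interpolates; rewrite Eend.
  do 3 (split; [assumption || lra|]); split; auto.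
  split; [lra|]; do 3 (split; [assumption|]).
  intros s Hs; rewrite curve_pos_oblique by exact CT; cbv zeta.
  destruct (coords_in_triangle k1 k2 kC beta d1 d2 sM sF Hk1 Hk2 Hbeta HS s Hs) as (T1 & T2 & T3).
  assert (T4 := coords_outside_circle k1 k2 kC beta d1 d2 sM sF Hk1 Hk2 Hbeta HS s Hs).
  set (X := RInt (fun r => cos _) 0 s) in *; set (Y := RInt (fun r => sin _) 0 s) in *.
  assert (P := tangent_power (sin beta) (cos beta) kC t X Y trig sin_pos HkC tangent_length); cbv zeta in P.
  assert (TL := tangent_length); assert (TC := tangent_length_le_clearance).
  set (x := t - X + Y * cos beta / sin beta) in *; set (y := Y / sin beta) in *.
  assert (Hx : 0 <= x).
  { apply Rmult_le_reg_r with (sin beta); auto; rewrite Rmult_0_l.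
    replace (x * sin beta) with (t * sin beta - X * sin beta + Y * cos beta) by (unfold x; field; lra); lra. }
  assert (Hxy : x + y <= t).
  { apply Rmult_le_reg_r with (sin beta); auto.
    replace ((x + y) * sin beta) with (t * sin beta - X * sin beta + Y * (1 + cos beta)) by (unfold x, y; field; lra).
    assert (S2 : sin beta = 2 * sin (beta / 2) * cos (beta / 2)).
    { rewrite <- sin_2a; f_equal; field. }
    assert (C2 : cos beta = 2 * cos (beta / 2) * cos (beta / 2) - 1).
    { rewrite <- cos_2a_cos; f_equal; field. }
    assert (H : Y * (1 + cos beta) <= X * sin beta); [|lra].
    rewrite S2, C2; assert (0 < cos (beta / 2)) by (apply cos_gt_0; lra); nra. }
  apply (safe_zone_intro p0 p1 p2 clr beta a b m l); auto.
  - apply Rdiv_le_0_compat; auto.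
  - fold c; lra.
  - fold c.
    (* Passage from the circle of the arc to the safe disk: the correction is nonnegative because
       [x + y <= t <= c]. *)
    replace (_ + _) with ((x ^ 2 + y ^ 2 - 2 * x * y * cos beta - 2 * t * (x + y) + t ^ 2)
      + (c - t) * (c + t - 2 * (x + y))) by ring.
    rewrite P; assert (0 <= (c - t) * (c + t - 2 * (x + y))) by (apply Rmult_le_pos; lra); lra.
Qed.

Lemma good_solves (prm : R * R * R * R) :
  good_clothoid_pair p0 p1 p2 clr beta kC aC LC k1 k2 prm -> solves k1 k2 kC beta prm.
Proof.
  destruct prm as [[[d1 d2] sM] sF]; intros (HM & Hj & HkM & (_ & _ & _ & Hb & _) & E).
  assert (CT := continuous_turn _ _ _ _ _ _ Hj).
  split; [|split; [exact HkM|]].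
  (* The rates are positive because the joint curvature exceeds [kC], hence [k1] and [k2]. *)
  - repeat split; auto; try lra; nra.
  - rewrite !curve_pos_oblique in E by (exact CT || exact turn_const_continuous).
    apply corner_pt_inj in E as [E1 E2]; auto.
    assert (EY : RInt (fun r => sin (turn (clothoid_pair_curv k1 k2 d1 d2 sM sF) r)) 0 sF =
      RInt (fun r => sin (turn (fun _ => kC) r)) 0 LC).
    { apply (f_equal (fun z => z * sin beta)) in E2.
      unfold Rdiv in E2; rewrite !Rmult_assoc, Rinv_l, !Rmult_1_r in E2 by lra; auto. }
    assert (EX : RInt (fun r => cos (turn (clothoid_pair_curv k1 k2 d1 d2 sM sF) r)) 0 sF =
      RInt (fun r => cos (turn (fun _ => kC) r)) 0 LC).
    { rewrite EY in E1; as_R; lra. }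
    intros v; rewrite RInt_sin_shift, EX, EY by exact CT.
    rewrite <- RInt_sin_shift, arc_length by exact turn_const_continuous.
    apply RInt_ext; intros; rewrite turn_const; auto.
Qed.
End Configuration.

(** * The parameters as a function of the end curvatures, the circle curvature and the angle *)

Lemma solves_unique (k1 k2 kC beta : R) (prm prm' : R * R * R * R) :
  beta < PI -> solves k1 k2 kC beta prm -> solves k1 k2 kC beta prm' -> prm = prm'.
Proof.
  destruct prm as [[[d1 d2] sM] sF], prm' as [[[d1' d2'] sM'] sF'].
  intros Hb (H & _ & E) (H' & _ & E').
  apply (tent_unique _ _ _ _ _ _ _ _ _ _ _ H H' Hb); intros v; rewrite E, E'; auto.
Qed.

Theorem theorem1 :
  exists F : R -> R -> R -> R -> R * R * R * R,
  forall (p0 p1 p2 : pt) (beta : R) (c : option R) (kC : R) (aC : pt) (LC : R),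
    signed_angle (vsub p1 p0) (vsub p2 p1) beta ->
    0 < Rabs beta <= PI / 2 ->
    valid_clearance c ->
    interpolates p0 p1 p2 c beta aC (fun _ => kC) LC ->
    forall k1 k2 : R,
      0 <= k1 < kC -> 0 <= k2 < kC ->
      good_clothoid_pair p0 p1 p2 c beta kC aC LC k1 k2 (F k1 k2 kC beta) /\
      (forall prm, good_clothoid_pair p0 p1 p2 c beta kC aC LC k1 k2 prm ->
         prm = F k1 k2 kC beta).
Proof.
  (* [F] is fixed before any corner is given, which is possible because [solves] mentions only these
     four reals. The zero tuple merely shows the type inhabited. *)
  exists (fun k1 k2 kC beta => epsilon (inhabits (0, 0, 0, 0)) (solves k1 k2 kC beta)).
  intros p0 p1 p2 beta c kC aC LC Hang Habs Hclr Hint k1 k2 Hk1 Hk2.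
  assert (HkC : 0 < kC) by lra.
  (* The angle is positive because it equals the turning [kC * LC] of the circle arc. *)
  assert (Hb : 0 < beta <= PI / 2).
  { destruct Hint as (HL & _ & _ & E & _); rewrite turn_const in E.
    assert (0 <= kC * LC) by (apply Rmult_le_pos; lra).
    rewrite Rabs_pos_eq in Habs; lra. }
  assert (Hb' : 0 < beta < PI) by (assert (P := PI_RGT_0); lra).
  destruct (corner_frame _ _ _ _ Hang) as (a & b & m & l & Hab & Hm & Hl & Eu & Ev).
  destruct (on_seg_first p0 p1 beta a b m Hm Eu aC) as (t & Ht & ->); [apply Hint|].
  assert (HF := epsilon_spec (inhabits (0, 0, 0, 0)) _ (solves_exists k1 k2 kC beta Hk1 Hk2 Hb')).
  split.
  - apply (solves_good p0 p1 p2 c beta kC a b m l); auto.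
  - intros prm Hprm; apply (solves_unique k1 k2 kC beta); [lra| |exact HF].
    apply (good_solves p0 p1 p2 c beta kC a b m t LC); auto.
Qed.
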